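(* Let $(X,d)$ be a dendrite and let $f:X\to X$ be a continuous monotone map. Then the set of all minimal sets of $f$, endowed with the Hausdorff metric, is compact.
   Context: A dendrite is a locally connected continuum (compact connected metric space) containing no simple closed curve. A map $f$ is monotone if the preimage of every connected set is connected. A minimal set of $f$ is a nonempty closed set $M\subset X$ with $f(M)\subset M$ that is minimal with respect to inclusion for these properties. The minimal sets are regarded as elements of the set $2^X$ of nonempty closed subsets of $X$, with the Hausdorff metric $d_H(A,B)=\max\{\sup_{x\in A}d(x,B),\sup_{y\in B}d(y,A)\}$. *)

(* Defs.v *)
From HB Require Import structures.
From mathcomp Require Import all_boot all_order all_algebra.
From mathcomp Require Import boolp classical_sets reals topology.
From mathcomp Require Import lra.

Set Implicit Arguments.
Unset Strict Implicit.
Unset Printing Implicit Defensive.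

Import Order.TTheory GRing.Theory Num.Theory.
Import numFieldTopology.Exports.
Local Open Scope classical_set_scope.
Local Open Scope ring_scope.

Definition locally_connected (T : topologicalType) : Prop :=
  forall (x : T) (U : set T), nbhs x U ->
    exists V : set T, [/\ open V, V x, connected V & V `<=` U].

(* [A] and [B], with their subspace topologies, are homeomorphic; [g] and [h]
   are total functions of which only the restrictions to [A] and [B] matter. *)
Definition homeomorphic (S T : topologicalType) (A : set S) (B : set T) : Prop :=
  exists (g : S -> T) (h : T -> S),
    [/\ g @` A `<=` B, h @` B `<=` A,
        {in A, cancel g h} & {in B, cancel h g}] /\
    {within A, continuous g} /\ {within B, continuous h}.

Definition circle (R : realType) : set (R * R) :=
  [set p | p.1 ^+ 2 + p.2 ^+ 2 = 1].

Definition simple_closed_curve (R : realType) (T : topologicalType)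
  (C : set T) : Prop := homeomorphic (@circle R) C.

Record dendrite (R : realType) (X : metricType R) : Prop := Dendrite {
  dendrite_compact : compact [set: X];
  dendrite_connected : connected [set: X];
  dendrite_locally_connected : locally_connected X;
  dendrite_no_simple_closed_curve :
    ~ exists C : set X, simple_closed_curve R C }.

Definition monotone_map (T : topologicalType) (f : T -> T) : Prop :=
  forall C : set T, connected C -> connected (f @^-1` C).

Definition closed_invariant (T : topologicalType) (f : T -> T) (M : set T) :=
  [/\ M !=set0, closed M & f @` M `<=` M].

Definition minimal_set (T : topologicalType) (f : T -> T) (M : set T) : Prop :=
  closed_invariant f M /\
  forall N : set T, closed_invariant f N -> N `<=` M -> N = M.

Section hausdorff_distance.
Context {R : realType} {X : metricType R}.
Implicit Types (x y : X) (A B C : set X).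

Definition set_dist x B : R := inf [set mdist x y | y in B].

(* [inf] and [sup] are meaningful here only for nonempty sets at bounded
   distance, e.g. nonempty subsets of a compact space. *)
Definition hausdorff_dist A B : R :=
  Num.max (sup [set set_dist x B | x in A]) (sup [set set_dist y A | y in B]).

Lemma set_dist_has_lb x B : has_lbound [set mdist x y | y in B].
Proof. by exists 0 => _ [y _ <-]; exact: mdist_ge0. Qed.

Lemma set_dist_ge0 x B : 0 <= set_dist x B.
Proof.
have [->|B0] := eqVneq B set0; first by rewrite /set_dist image_set0 inf0.
apply: lb_le_inf; first by apply/image_nonempty/set0P.
by move=> _ [y _ <-]; exact: mdist_ge0.
Qed.

Lemma set_dist_le x B y : B y -> set_dist x B <= mdist x y.
Proof. by move=> By; apply: ge_inf; [exact: set_dist_has_lb|exists y]. Qed.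

Lemma set_dist_adherent x B (e : R) : B !=set0 -> 0 < e ->
  exists2 y, B y & mdist x y < set_dist x B + e.
Proof.
move=> B0 e0.
have hB : has_inf [set mdist x y | y in B].
  by split; [apply/image_nonempty|exact: set_dist_has_lb].
by have [_ [y By <-] yB] := inf_adherent e0 hB; exists y.
Qed.

Lemma set_dist_self x B : B x -> set_dist x B = 0.
Proof.
move=> Bx; apply/eqP; rewrite eq_le set_dist_ge0 andbT.
by rewrite -(mdistxx x) set_dist_le.
Qed.

Lemma set_dist0_closed x B :
  B !=set0 -> closed B -> set_dist x B = 0 -> B x.
Proof.
move=> B0 cB xB; apply: cB => U /nbhs_ballP[e /= e0 xeU].
have [y By] := set_dist_adherent x B0 e0.
rewrite xB add0r => xy; exists y; split=> //.
by apply: xeU; rewrite ballEmdist.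
Qed.

Hypothesis cX : compact [set: X].

Lemma compact_mdist_bounded x0 : exists D : R, forall x, mdist x0 x <= D.
Proof.
apply: contrapT => unbounded.
pose far r : set X := [set x | r <= mdist x0 x].
pose F : set_system X := filter_from setT far.
have FF : ProperFilter F.
  apply: filter_from_proper => [|r _]; last first.
    apply: contrapT => far0; apply: unbounded; exists r => x.
    by apply/ltW; rewrite ltNge; apply/negP => rx; apply: far0; exists x.
  apply: filter_fromT_filter; first by exists 0.
  by move=> r s; exists (Num.max r s) => x; rewrite /far /= ge_max => /andP.
have [p [_ Fp]] := cX FF filterT.
have [||x []] := Fp (far (mdist x0 p + 1)) (ball p 1).
- by exists (mdist x0 p + 1).
- exact: nbhsx_ballx.
rewrite /far /= ballEmdist /=.
have := metric_triangle x0 p x.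
lra.
Qed.

Lemma set_dist_has_ub A B : B !=set0 -> has_ubound [set set_dist x B | x in A].
Proof.
move=> [b Bb]; have [D HD] := compact_mdist_bounded b.
exists D => _ [x _ <-]; rewrite (le_trans (set_dist_le x Bb)) //.
by rewrite metric_sym.
Qed.

Lemma set_dist_le_hausdorff A B x : B !=set0 -> A x ->
  set_dist x B <= hausdorff_dist A B.
Proof.
move=> B0 Ax; rewrite le_max; apply/orP; left.
by apply: ub_le_sup; [exact: set_dist_has_ub|exists x].
Qed.

Lemma hausdorff_dist_sym A B : hausdorff_dist A B = hausdorff_dist B A.
Proof. by rewrite /hausdorff_dist maxC. Qed.

Lemma hausdorff_dist_self A : A !=set0 -> hausdorff_dist A A = 0.
Proof.
move=> A0; rewrite /hausdorff_dist maxxx.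
suff -> : [set set_dist x A | x in A] = [set 0] by rewrite sup1.
apply/seteqP; split=> [_ [x Ax <-]|_ ->] /=; first by rewrite set_dist_self.
by have [a Aa] := A0; exists a => //; rewrite set_dist_self.
Qed.

Lemma hausdorff_dist0_sub A B : B !=set0 -> closed B ->
  hausdorff_dist A B = 0 -> A `<=` B.
Proof.
move=> B0 cB AB x Ax; apply: set_dist0_closed => //.
by apply/eqP; rewrite eq_le set_dist_ge0 -AB set_dist_le_hausdorff.
Qed.

Lemma set_dist_triangle A B C x : A !=set0 -> B !=set0 -> C !=set0 -> A x ->
  set_dist x C <= hausdorff_dist A B + hausdorff_dist B C.
Proof.
move=> A0 B0 C0 Ax; apply/ler_addgt0Pl => e e0.
have e20 : 0 < e / 2 by rewrite divr_gt0.
have [y By xy] := set_dist_adherent x B0 e20.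
have [z Cz yz] := set_dist_adherent y C0 e20.
have := set_dist_le x Cz.
have := metric_triangle x y z.
have := set_dist_le_hausdorff B0 Ax.
have := set_dist_le_hausdorff C0 By.
lra.
Qed.

Lemma hausdorff_dist_triangle B A C : A !=set0 -> B !=set0 -> C !=set0 ->
  hausdorff_dist A C <= hausdorff_dist A B + hausdorff_dist B C.
Proof.
move=> A0 B0 C0; rewrite {1}/hausdorff_dist ge_max; apply/andP; split.
- apply: ge_sup; first exact/image_nonempty.
  by move=> _ [x Ax <-]; exact: set_dist_triangle.
- apply: ge_sup; first exact/image_nonempty.
  move=> _ [x Cx <-]; rewrite addrC (hausdorff_dist_sym A) (hausdorff_dist_sym B).
  exact: set_dist_triangle.
Qed.

End hausdorff_distance.

(* The space 2^X. Compactness of [X] is a parameter because it makes the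
   Hausdorff distance finite, hence a metric. *)
Record hyperspace (R : realType) (X : metricType R) (cX : compact [set: X]) :=
  Hyperspace {
    hyperspace_set :> set X;
    hyperspace_neq0 : hyperspace_set !=set0;
    hyperspace_closed : closed hyperspace_set }.

Section hyperspace_metric.
Context {R : realType} {X : metricType R} {cX : compact [set: X]}.
Implicit Types A B C : hyperspace cX.

HB.instance Definition _ := gen_eqMixin (hyperspace cX).
HB.instance Definition _ := gen_choiceMixin (hyperspace cX).

Definition hyperspace_dist A B : R := hausdorff_dist A B.

Lemma hyperspace_dist_self A : hyperspace_dist A A = 0.
Proof. exact: hausdorff_dist_self (hyperspace_neq0 A). Qed.

Lemma hyperspace_dist_positivity A B : hyperspace_dist A B = 0 -> A = B.
Proof.
case: A B => [A A0 cA] [B B0 cB]; rewrite /hyperspace_dist /= => AB.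
have eAB : A = B.
  apply/seteqP; split; first exact: (hausdorff_dist0_sub cX).
  by apply: (hausdorff_dist0_sub cX) => //; rewrite hausdorff_dist_sym.
by subst B; congr Hyperspace; exact: Prop_irrelevance.
Qed.

Lemma hyperspace_dist_sym A B : hyperspace_dist A B = hyperspace_dist B A.
Proof. exact: hausdorff_dist_sym. Qed.

Lemma hyperspace_dist_triangle B A C :
  hyperspace_dist A C <= hyperspace_dist A B + hyperspace_dist B C.
Proof.
by apply: (hausdorff_dist_triangle cX); exact: hyperspace_neq0.
Qed.

HB.instance Definition _ := isMetric.Build R (hyperspace cX)
  hyperspace_dist_self hyperspace_dist_positivity hyperspace_dist_sym
  hyperspace_dist_triangle.

End hyperspace_metric.

(* Main.v *)
(** In a dendrite, [btw a b] (the points lying in every connected set containing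
    [a] and [b]) is an arc: two arcs with the same ends that differ would bound a
    circle.  A monotone map preserves betweenness, hence permutes the components
    of the complement of a fixed point [p] that meet a compact invariant set off
    [p], and a minimal set that is not a single point has a fixed point
    separating it.  So its pieces are permuted cyclically, and each piece is
    minimal for an iterate of the map.

    Let [K] be a limit of minimal sets [M].  If [K] contains a fixed point [p],
    the fixed points separating the [M] must tend to [p], and even equal [p];
    applied to an iterate and to the piece of [M] in one component, this is
    absurd unless [K] is [[set p]].  In general let [L] be a minimal subset of
    [K] and suppose that [K] has a point [y] off [L].  Cutting [L] repeatedly at
    separating fixed points [p j] of iterates yields nested pieces that also cut
    the sets [M] close to [K].  The cluster points of [p] lie in [L], so [p j]
    eventually avoids a connected neighbourhood of [y]; a set [M] meeting this
    neighbourhood then follows [L] at all levels, so the cluster points of [p]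
    lie in [M] as well, and [M] is [L], a contradiction. *)
Require Import Defs.
From mathcomp Require Import all_boot all_order all_algebra.
From mathcomp Require Import boolp classical_sets reals topology.
From mathcomp Require Import normedtype realfun.
From mathcomp Require Import lra zify.

Set Implicit Arguments.
Unset Strict Implicit.
Unset Printing Implicit Defensive.

Import Order.TTheory GRing.Theory Num.Theory.
Import numFieldNormedType.Exports.
Local Open Scope classical_set_scope.
Local Open Scope ring_scope.

(** * Betweenness and branches *)

Section betweenness.
Context {T : topologicalType}.
Implicit Types (a b c p z : T) (C E U W : set T).

Definition btw a b : set T :=
  [set z | forall C, connected C -> C a -> C b -> C z].

(* The component of [a] in the complement of [p]; it is empty when [p = a]. *)
Definition branch p a : set T := [set b | ~ btw a b p].

Lemma btwl a b : btw a b a. Proof. by move=> C. Qed.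

Lemma btwr a b : btw a b b. Proof. by move=> C. Qed.

Lemma btwC a b : btw a b = btw b a.
Proof. by apply/seteqP; split=> z ab C cC Ca Cb; exact: ab. Qed.

Lemma btwPn a b z :
  ~ btw a b z <-> exists2 C, connected C & [/\ C a, C b & ~ C z].
Proof.
split=> [|[C cC [Ca Cb Cz]] /(_ C cC Ca Cb)//].
move=> /existsNP[C /not_implyP[cC /not_implyP[Ca /not_implyP[Cb Cz]]]].
by exists C.
Qed.

Lemma btw_sub a b C : connected C -> C a -> C b -> btw a b `<=` C.
Proof. by move=> cC Ca Cb z; exact. Qed.

Lemma btw_refl a : btw a a = [set a].
Proof.
apply/seteqP; split; last by move=> _ ->; exact: btwl.
by apply: btw_sub => //; exact: connected1.
Qed.

Lemma nbtwC a b p : ~ btw a b p -> ~ btw b a p.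
Proof. by rewrite btwC. Qed.

Lemma nbtw_trans b a c p : ~ btw a b p -> ~ btw b c p -> ~ btw a c p.
Proof.
move=> /btwPn[C cC [Ca Cb Cp]] /btwPn[D cD [Db Dc Dp]]; apply/btwPn.
exists (C `|` D); last by split; [left|right|case].
by apply: connectedU => //; exists b.
Qed.

Lemma nbtw_refl a p : p <> a -> ~ btw a a p.
Proof. by rewrite btw_refl. Qed.

Lemma nbtw_neql a b p : ~ btw a b p -> p <> a.
Proof. by move=> + pa; apply; rewrite pa; exact: btwl. Qed.

Lemma nbtw_neqr a b p : ~ btw a b p -> p <> b.
Proof. by move=> + pb; apply; rewrite pb; exact: btwr. Qed.

Lemma branch_connected p a : connected (branch p a).
Proof.
have -> : branch p a =
    \bigcup_(C in [set C | [/\ connected C, C a & ~ C p]]) C.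
  apply/seteqP; split=> [b /btwPn[C cC [Ca Cb Cp]]|b [C [cC Ca Cp] Cb]].
    by exists C.
  by apply/btwPn; exists C.
apply: bigcup_connected; last by move=> C [].
by exists a => C [].
Qed.

Lemma branchE p a b : branch p a b -> branch p a = branch p b.
Proof.
move=> ab; apply/seteqP; split=> c; apply: nbtw_trans => //.
by rewrite btwC.
Qed.

Lemma nbtw_notin p a : ~ branch p a p.
Proof. by move=> H; apply: H; exact: btwr. Qed.

Section locally_connected.
Hypothesis hT : hausdorff_space T.
Hypothesis lcT : locally_connected T.

Lemma nbhs_neq (x y : T) : x <> y -> nbhs x (~` [set y]).
Proof.
move=> xy; apply: open_nbhs_nbhs; split=> //.
by apply/closed_openC/accessible_closed_set1; exact: hausdorff_accessible.
Qed.

Lemma connected_nbhs_avoid p a : p <> a ->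
  exists2 W, open_nbhs a W & connected W /\ ~ W p.
Proof.
move=> pa; have /lcT[W [oW Wa cW Wp]] : nbhs a (~` [set p]).
  apply: open_nbhs_nbhs; split; last by move=> /= ap; apply: pa.
  apply/closed_openC/accessible_closed_set1; exact: hausdorff_accessible.
by exists W => //; split=> // /Wp; apply.
Qed.

Lemma connected_disjoint_nbhs (x y : T) : x <> y -> exists U V : set T,
  [/\ open_nbhs x U /\ connected U, open_nbhs y V /\ connected V &
      U `&` V = set0].
Proof.
move=> xy; have := hT; rewrite open_hausdorff => /(_ x y)[].
  exact/eqP.
move=> [A B] /= [/set_mem Ax /set_mem By] [oA oB AB].
have [U [oU Ux cU UA]] := lcT (open_nbhs_nbhs (conj oA Ax)).
have [V [oV Vy cV VB]] := lcT (open_nbhs_nbhs (conj oB By)).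
exists U, V; split=> //; apply/seteqP; split=> // z [Uz Vz].
by rewrite -(eqP AB); split; [exact: UA|exact: VB].
Qed.

Lemma branch_open p a : open (branch p a).
Proof.
rewrite openE => b ab.
have [W [oW Wb] [cW Wp]] := connected_nbhs_avoid (nbtw_neqr ab).
apply: (@filterS _ _ _ W); last exact: open_nbhs_nbhs.
by move=> c Wc; apply: nbtw_trans ab _; apply/btwPn; exists W.
Qed.

Lemma branch_nbhs p a b : branch p a b -> nbhs b (branch p a).
Proof. by move=> ab; apply: open_nbhs_nbhs; split=> //; exact: branch_open. Qed.

Lemma branch_nbhs_self p a : p <> a -> nbhs a (branch p a).
Proof. by move=> pa; apply: branch_nbhs; exact: nbtw_refl. Qed.

Lemma branch_closure p a : closure (branch p a) `<=` branch p a `|` [set p].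
Proof.
move=> b clb; have [->|pb] := pselect (p = b); first by right.
left; have [c [ac bc]] := clb _ (branch_nbhs_self pb).
by apply: nbtw_trans ac (nbtwC bc).
Qed.

Hypothesis connT : connected [set: T].

(** For [z <> w], the closure of [branch z a] is the branch with [z] added, since otherwise the
    branch would be clopen. This closure is connected, so it contains [w], and then [z] does not
    separate [a] from [w]. *)
Lemma btw_antisym a w z : btw a w z -> btw a z w -> z = w.
Proof.
move=> awz azw; apply: contrapT => zw.
have [za|za] := pselect (z = a).
  by move: azw; rewrite za btw_refl => wa; apply: zw; rewrite za wa.
suff clz : closure (branch z a) z.
  have cla : closure (branch z a) a.
    by apply: subset_closure; exact: nbtw_refl.
  have := azw _ (connected_closure (@branch_connected z a)) cla clz.
  by move=> /branch_closure[//|/= wz]; apply: zw.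
apply: contrapT => clz; suff : branch z a z by exact: nbtw_notin.
have -> : branch z a = [set: T]; last by [].
apply: connT; first by exists a; exact: nbtw_refl.
  by exists (branch z a); [exact: branch_open|rewrite setTI].
exists (branch z a); last by rewrite setTI.
move=> b /[dup] clb /branch_closure[//|bz].
by case: clz; rewrite -{2}bz.
Qed.

End locally_connected.
End betweenness.

(** * Arcs in locally connected compact metric spaces *)

Lemma truncn_mulr_div (R : realType) (x : R) (r : nat) : (0 < r)%N ->
  (Num.truncn (x * r%:R) %/ r)%N = Num.truncn x.
Proof.
move=> r0; have r0' : 0 < r%:R :> R by rewrite ltr0n.
suff H n : (n < Num.truncn (x * r%:R) %/ r)%N = (n < Num.truncn x)%N.
  apply/eqP; rewrite eqn_leq; apply/andP; split; rewrite leqNgt.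
    by rewrite H ltnn.
  by rewrite -H ltnn.
rewrite leq_divRL // truncn_gt_nat.
have -> : (n.+1 * r)%N = (n.+1 * r).-1.+1 by rewrite prednK // muln_gt0.
by rewrite truncn_gt_nat prednK ?muln_gt0 // natrM ler_pM2r.
Qed.

(** * Paths as limits of refining chains of small connected open sets *)

Section paths.
Context {R : realType} {X : metricType R}.
Hypotheses (cX : compact [set: X]) (lcX : locally_connected X).
Implicit Types (E U : set X) (a b : X).

Let hX : hausdorff_space X := metric_hausdorff (T := X).

Definition link n E V := [/\ open V, connected V, closure V `<=` E &
  forall x y, V x -> V y -> mdist x y <= n.+1%:R^-1].

Lemma link_exists n E x : open E -> E x -> exists2 V, link n E V & V x.
Proof.
move=> oE Ex.
have e0 : 0 < (n.+1%:R^-1 / 2 : R) by rewrite divr_gt0 // invr_gt0.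
have [W xW WE] := compact_regular hX cX filterT (open_nbhs_nbhs (conj oE Ex)).
have [V [oV Vx cV VW]] := lcX (filterI xW (nbhsx_ballx x _ e0)).
exists V => //; split=> //.
  by apply: subset_trans WE; apply: closure_subset => y /VW[].
move=> y z /VW[_ +] /VW[_]; rewrite !ballEmdist /= => xy xz.
rewrite [leRHS](splitr n.+1%:R^-1) (le_trans (metric_triangle y x z)) //.
by rewrite (metric_sym y x) lerD // ltW.
Qed.

(** Padding by the constant [b] from index [l] on makes every index meaningful, in particular the
    truncation of any real number. *)
Definition chain n E a b (c : nat -> X) (V : nat -> set X) l :=
  [/\ c 0%N = a, (forall i, (l <= i)%N -> c i = b) &
      forall i, [/\ link n E (V i), V i (c i) & V i (c i.+1)]].

Lemma chain_extend n E a b b' c (V : nat -> set X) l W : chain n E a b c V l ->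
  link n E W -> W b -> W b' -> exists c' V' l', chain n E a b' c' V' l'.
Proof.
move=> [c0 cl cV] lW Wb Wb'.
exists (fun i => if (i <= l)%N then c i else b').
exists (fun i => if (i < l)%N then V i else W), l.+1; split=> [|i|i].
- by rewrite leq0n.
- by rewrite ltnNge => /negbTE ->.
- have [il|li|->] := ltngtP i l.
  + by have := cV i.
  + by split=> //; rewrite ltnNge (ltnW li).
  + by rewrite cl.
Qed.

(** The points of [E] reachable from [a] form a nonempty clopen subset of [E]. The clause on [a = b]
    keeps the constant tail of a chain constant under refinement. *)
Lemma chain_exists n E a b : open E -> connected E -> E a -> E b ->
  exists c V l, chain n E a b c V l /\ (a = b -> l = 0%N).
Proof.
move=> oE cE Ea Eb.
have [V0 lV0 V0a] := link_exists n oE Ea.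
have ch0 : chain n E a a (fun=> a) (fun=> V0) 0 by split.
have [<-|ab] := pselect (a = b); first by exists (fun=> a), (fun=> V0), 0%N.
pose Q := [set x | E x /\ exists c V l, chain n E a x c V l].
suff QE : Q = E.
  have [_ [c [V [l ch]]]] : Q b by rewrite QE.
  by exists c, V, l; split=> // /ab.
have ext x y V : link n E V -> V x -> V y -> Q x -> Q y.
  move=> lV Vx Vy [_ [c [W [l ch]]]]; split; last exact: chain_extend ch lV Vx Vy.
  by have [_ _ + _] := lV; apply; exact: subset_closure.
apply: cE.
- by exists a; split=> //; exists (fun=> a), (fun=> V0), 0%N.
- exists Q; last by apply/seteqP; split=> [x Qx|x []//]; split=> //; case: Qx.
  rewrite openE => x Qx; have [V lV Vx] := link_exists n oE Qx.1.
  have [oV _ _ _] := lV.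
  apply: (@filterS _ _ _ V); last by apply: open_nbhs_nbhs.
  by move=> y Vy; exact: (ext x y V lV Vx Vy Qx).
- exists (closure Q); first exact: closed_closure.
  apply/seteqP; split=> [x Qx|x [Ex clx]].
    by split; [case: Qx|exact: subset_closure].
  have [V lV Vx] := link_exists n oE Ex; have [oV _ _ _] := lV.
  have [y [Qy Vy]] := clx V (open_nbhs_nbhs (conj oV Vx)).
  exact: (ext y x V lV Vy Vx Qy).
Qed.

(** Each link is replaced by a chain running inside it from [c i] to [c i.+1]. Padding gives these
    chains a common length [r], so that the new link [k] sits in the old link [k %/ r]. *)
Lemma chain_refine n m U a b c (V : nat -> set X) l : chain n U a b c V l ->
  exists r c' V', [/\ (0 < r)%N, chain m U a b c' V' (l * r) &
    forall i, closure (V' i) `<=` V (i %/ r)%N].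
Proof.
move=> [c0 cl cV].
have /choice[d dP] : forall i, exists d : (nat -> X) * (nat -> set X) * nat,
    chain m (V i) (c i) (c i.+1) d.1.1 d.1.2 d.2 /\ (c i = c i.+1 -> d.2 = 0%N).
  move=> i; have [[oV cnV _ _] Vi Vi1] := cV i.
  have [e [W [k]]] := chain_exists m oV cnV Vi Vi1.
  by exists (e, W, k).
(* The maximum over [i < l] suffices: from [l] on the chains join equal points and have length
   [0]. *)
pose r := (\max_(i < l) (d i).2).+1.
have dr i : ((d i).2 < r)%N.
  have [il|li] := ltnP i l; first exact: (leq_bigmax (Ordinal il)).
  have [_ ->//] := dP i; rewrite !cl //; exact: leqW.
pose c' k := (d (k %/ r)%N).1.1 (k %% r)%N.
have c'E i j : (j <= r)%N -> c' (i * r + j)%N = (d i).1.1 j.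
  rewrite leq_eqVlt => /orP[/eqP->|jr]; last first.
    by rewrite /c' divnMDl // modnMDl divn_small // addn0 modn_small.
  rewrite addnC -mulSn /c' mulnK // modnMl.
  have [[-> _ _] _] := dP i.+1.
  by have [[_ cb _] _] := dP i; rewrite cb //; exact/ltnW/dr.
exists r, c', (fun k => (d (k %/ r)%N).1.2 (k %% r)%N); split=> //.
- split=> [|k lrk|k].
  + by rewrite /c' div0n mod0n; have [[-> _ _] _] := dP 0%N.
  + have lk : (l <= k %/ r)%N by rewrite leq_divRL.
    have [[_ + _] d0] := dP (k %/ r)%N.
    rewrite /c' => ->; first by rewrite cl // leqW.
    by rewrite d0 // !cl // leqW.
  + have [[_ _ dV] _] := dP (k %/ r)%N.
    have [[oV cnV clV sV] Vk Vk1] := dV (k %% r)%N.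
    have [[_ _ VU _] _ _] := cV (k %/ r)%N.
    split=> //.
      split=> //; apply: subset_trans clV _.
      by apply: subset_trans VU; exact: subset_closure.
    have -> : k.+1 = (k %/ r * r + (k %% r).+1)%N by rewrite addnS -divn_eq.
    by rewrite c'E // ltn_mod.
- by move=> k; have [[_ _ /(_ (k %% r)%N)[[_ _ + _] _ _]] _] := dP (k %/ r)%N.
Qed.

(** With [r n] links per unit of time at level [n], the point [g t] is common to the links whose
    index is the truncation of [t * r n], for all [n]; compactness provides it. *)
Lemma path_exists U a b : open U -> connected U -> U a -> U b ->
  exists (g : R -> X) (l : nat), [/\ continuous g, forall t, U (g t), g 0 = a &
    g l%:R = b].
Proof.
move=> oU cU Ua Ub.
have [c0 [V0 [l [ch0 _]]]] := chain_exists 0 oU cU Ua Ub.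
pose St := {s : nat * (nat -> X) * (nat -> set X) * nat |
  let: (n, c, V, r) := s in chain n U a b c V (l * r) /\ (0 < r)%N}.
have P0 : chain 0 U a b c0 V0 (l * 1) /\ (0 < 1)%N by rewrite muln1.
pose st0 : St := exist _ (0%N, c0, V0, 1%N) P0.
pose nxt (s s' : St) := let: (n, c, V, r) := sval s in
  let: (n', c', V', r') := sval s' in n' = n.+1 /\ exists k,
  [/\ (0 < k)%N, r' = (r * k)%N & forall i, closure (V' i) `<=` V (i %/ k)%N].
have [|st [st0E stS]] := @dependent_choice St nxt _ st0.
  move=> [[[[n c] V] r] [ch r0]]; apply: cid.
  have [k [c' [V' [k0 ch' cl]]]] := chain_refine n.+1 ch.
  rewrite -mulnA in ch'.
  have kr0 : (0 < r * k)%N by rewrite muln_gt0 r0.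
  by exists (exist _ (n.+1, c', V', (r * k)%N) (conj ch' kr0)); split=> //; exists k.
pose c n := (sval (st n)).1.1.2; pose V n := (sval (st n)).1.2.
pose r n := (sval (st n)).2.
have stn n : (sval (st n)).1.1.1 = n.
  elim: n => [|n IH]; first by rewrite st0E.
  have := stS n; rewrite /nxt.
  move: IH; case: (sval (st n)) => [[[n1 c1] V1] r1] /= ->.
  by case: (sval (st n.+1)) => [[[n2 c2] V2] r2] /= [->].
have ch n : chain n U a b (c n) (V n) (l * r n) /\ (0 < r n)%N.
  have := svalP (st n); have := stn n; rewrite /c /V /r.
  by case: (sval (st n)) => [[[n1 c1] V1] r1] /= ->.
have nx n : exists k, [/\ (0 < k)%N, r n.+1 = (r n * k)%N &
    forall i, closure (V n.+1 i) `<=` V n (i %/ k)%N].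
  have := stS n; rewrite /nxt /r /V.
  case: (sval (st n)) => [[[n1 c1] V1] r1] /=.
  by case: (sval (st n.+1)) => [[[n2 c2] V2] r2] /= [].
have r0 : r 0%N = 1%N by rewrite /r st0E.
clearbody c V r; clear stn stS st0E st nxt st0 St.
pose idx n (t : R) := Num.truncn (t * (r n)%:R).
have nest n t : closure (V n.+1 (idx n.+1 t)) `<=` V n (idx n t).
  have [k [k0 rk cl]] := nx n; have := cl (idx n.+1 t).
  by rewrite /idx rk natrM mulrA truncn_mulr_div.
have sub n m t : (n <= m)%N -> V m (idx m t) `<=` V n (idx n t).
  elim: m => [|m IH]; first by rewrite leqn0 => /eqP->.
  rewrite leq_eqVlt => /orP[/eqP->//|/IH]; apply: subset_trans.
  by apply: subset_trans (nest m t); exact: subset_closure.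
have /choice[g gV] : forall t, exists x, forall n, V n (idx n t) x.
  move=> t.
  have FF : ProperFilter (filter_from setT (fun n => V n (idx n t))).
    apply: filter_from_proper => [|n _].
      apply: filter_fromT_filter; first by exists 0%N.
      move=> i j; exists (maxn i j) => x Vx.
      by split; apply: sub Vx; rewrite ?leq_maxl ?leq_maxr.
    by have [[_ _ /(_ (idx n t))[_ Vc _]] _] := ch n; exists (c n (idx n t)).
  have [x [_ Fx]] := cX FF filterT; exists x => n; apply: nest => B xB.
  by apply: Fx => //; exists n.+1.
have diam n i x y : V n i x -> V n i y -> mdist x y <= n.+1%:R^-1.
  by have [[_ _ /(_ i)[[_ _ _ H] _ _]] _] := ch n; exact: H.
have inv_small (e : R) : 0 < e -> exists n : nat, n.+1%:R^-1 < e.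
  move=> e0; exists (Num.truncn e^-1).
  by rewrite invf_plt ?posrE // truncnS_gt.
have uniq t x : (forall n, V n (idx n t) x) -> g t = x.
  move=> Vx; apply: mdist_positivity; apply/eqP.
  rewrite eq_le mdist_ge0 andbT leNgt; apply/negP => /inv_small[n].
  by rewrite ltNge (diam n (idx n t)).
exists g, l; split.
- move=> t B /nbhs_ballP[e /= e0 tB].
  have e20 : 0 < e / 2 by rewrite divr_gt0.
  have [n ne] := inv_small _ e20.
  have rn0 : 0 < (r n)%:R :> R by rewrite ltr0n; have [] := ch n.
  apply/nbhs_ballP; exists (r n)%:R^-1 => /=; first by rewrite invr_gt0.
  move=> s; rewrite /ball /= => ts; apply: tB; rewrite ballEmdist /=.
  (* The indices of [s] and [t] at level [n] are then equal or consecutive, and consecutive links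
     share a point of the chain. *)
  have tsr : `|t * (r n)%:R - s * (r n)%:R| < 1.
    by rewrite -mulrBl normrM (gtr0_norm rn0) -ltr_pdivlMr // mul1r.
  have near i j x y : (i <= j <= i.+1)%N -> V n i x -> V n j y ->
      mdist x y <= n.+1%:R^-1 + n.+1%:R^-1.
    move=> ij Vx Vy.
    have [[_ _ cV] _] := ch n.
    have [ji|ji] : j = i \/ j = i.+1 by lia.
      rewrite ji in Vy; apply: le_trans (diam _ _ _ _ Vx Vy) _.
      by rewrite lerDl invr_ge0.
    have [_ _ Vc] := cV i; have [_ Vc' _] := cV j; rewrite ji in Vc' Vy.
    apply: le_trans (metric_triangle _ (c n i.+1) _) _.
    by apply: lerD; [exact: diam Vx Vc|exact: diam Vc' Vy].
  have le1 (x y : R) : `|x - y| < 1 -> x <= y ->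
      (Num.truncn x <= Num.truncn y <= (Num.truncn x).+1)%N.
    move=> xy1 xy; rewrite le_truncn //= truncn_le_nat -natr1.
    move: xy1 (truncnS_gt x).
    by rewrite distrC ger0_norm ?subr_ge0 // -natr1; lra.
  suff : mdist (g t) (g s) <= n.+1%:R^-1 + n.+1%:R^-1.
    by move=> /le_lt_trans; apply; rewrite [ltRHS]splitr ltrD.
  have [ts'|/ltW st'] := leP (t * (r n)%:R) (s * (r n)%:R).
    by apply: near (gV t n) (gV s n); exact: le1.
  rewrite metric_sym; apply: near (gV s n) (gV t n); apply: le1 => //.
  by rewrite distrC.
- move=> t; have [[_ _ /(_ (idx 0%N t))[[_ _ VU _] _ _]] _] := ch 0%N.
  by apply: VU; apply: subset_closure; exact: gV.
- apply: uniq => n; have [[<- _ cV] _] := ch n.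
  by rewrite /idx mul0r truncn0; have [] := cV 0%N.
- apply: uniq => n; have [[_ cb cV] _] := ch n.
  rewrite /idx -natrM natrK -(cb _ (leqnn _)).
  by have [] := cV (l * r n)%N.
Qed.

(** A path from [a] to [b] inside [branch z a] has a compact image [K] off [z]. Points near [a] and
    [b] are attached to [K] by small connected sets, and a point near [z] avoids all three. *)
Lemma btw_near a b z : ~ btw a b z ->
  exists A B Z, [/\ nbhs a A, nbhs b B, nbhs z Z &
    forall a' b' z', A a' -> B b' -> Z z' -> ~ btw a' b' z'].
Proof.
move=> abz; have za := nbtw_neql abz; have zb := nbtw_neqr abz.
have [g [l [cg gU g0 gl]]] := path_exists (branch_open hX lcX z a)
  (@branch_connected _ z a) (nbtw_refl za) abz.
have [A [Za [[oA cA] [oZa _] AZa]]] := connected_disjoint_nbhs hX lcX (nesym za).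
have [B [Zb [[oB cB] [oZb _] BZb]]] := connected_disjoint_nbhs hX lcX (nesym zb).
pose K := g @` `[0, l%:R].
have cgK : {within `[0, l%:R], continuous g} by exact: continuous_subspaceT.
have cK : closed K.
  apply: compact_closed => //; apply: continuous_compact => //.
  exact: segment_compact.
have connK : connected K.
  by apply: connected_continuous_connected => //; exact: segment_connected.
exists A, B, (~` K `&` (Za `&` Zb)); split.
- exact: open_nbhs_nbhs.
- exact: open_nbhs_nbhs.
- apply: filterI; last by apply: filterI; exact: open_nbhs_nbhs.
  apply: open_nbhs_nbhs; split; first exact: closed_openC.
  by move=> [t _ gt]; have := gU t; rewrite gt; exact: nbtw_notin.
move=> a' b' z' Aa' Bb' [Kz' [Zaz' Zbz']].
apply: (@nbtw_trans _ a).
  apply/btwPn; exists A => //; split=> //; first by case: oA.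
  by move=> Az'; have : set0 z' by rewrite -AZa.
apply: (@nbtw_trans _ b).
  apply/btwPn; exists K => //; split=> //.
    by exists 0 => //; rewrite /= in_itv /= lexx ler0n.
  by exists l%:R => //; rewrite /= in_itv /= lexx ler0n.
apply/btwPn; exists B => //; split=> //; first by case: oB.
by move=> Bz'; have : set0 z' by rewrite -BZb.
Qed.

End paths.

Lemma closed_max_le (R : realType) (C : set R) (x : R) : closed C ->
  (exists2 y, C y & y <= x) ->
  exists m, [/\ C m, m <= x & forall y, C y -> y <= x -> y <= m].
Proof.
move=> cC [y Cy yx]; pose S := C `&` [set z | z <= x].
have S0 : S !=set0 by exists y.
have Sx : ubound S x by move=> z [].
have hS : has_ubound S by exists x.
have Ssup : S (sup S).
  by apply: (closedI cC (@closed_le _ x)); exact: closure_sup.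
exists (sup S); split=> [||z Cz zx]; [by case: Ssup..|].
by apply: ub_le_sup.
Qed.

Lemma closed_min_ge (R : realType) (C : set R) (x : R) : closed C ->
  (exists2 y, C y & x <= y) ->
  exists m, [/\ C m, x <= m & forall y, C y -> x <= y -> m <= y].
Proof.
move=> cC [y Cy xy].
have cN : closed (-%R @^-1` C).
  apply: preimage_closed => //; by move=> t _; exact: opp_continuous.
have [|m [Cm mx mM]] := @closed_max_le R (-%R @^-1` C) (- x) cN.
  by exists (- y); rewrite ?lerN2 //= opprK.
exists (- m); split=> // [|z Cz xz]; first by rewrite lerNr.
by rewrite lerNl; apply: mM; rewrite /= ?opprK // lerN2.
Qed.

(** * Removing the loops of a path *)

Section collapse.
Context {R : realType} {X : metricType R}.
Context (g : R -> X) (cg : continuous g) (T : R).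

Let continuous_mdist t e : 0 < e -> exists2 d, 0 < d &
  forall s, `|s - t| < d -> mdist (g t) (g s) < e.
Proof.
move=> e0; have /nbhs_ballP[d /= d0 dP] := cg (nbhsx_ballx (g t) e e0).
exists d => // s st; have := dP s; rewrite /= ballEmdist /=; apply.
by rewrite /ball /= distrC.
Qed.

(** The pairs [s < t] considered are the ends of the components of [O]; over each of them [g] runs
    through a loop that can be frozen. *)
Definition collapsible : set (set R) := [set O | [/\ open O,
  O `<=` `]0, T[ & forall s t, s < t -> ~ O s -> ~ O t -> `]s, t[ `<=` O ->
  g s = g t]].

(** Given a component []s, t[] of the union, compactness puts a slightly smaller interval inside one
    member of the chain. The component of that member around it has ends close to [s] and [t] with
    equal values of [g], and continuity concludes. *)
Lemma collapsible_bigcup (F : set (set R)) : F `<=` collapsible ->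
  total_on F subset -> collapsible (\bigcup_(O in F) O).
Proof.
move=> Fc totF; split.
- by apply: bigcup_open => O /Fc[].
- by move=> t [O /Fc[_ OT _] /OT].
move=> s t st nOs nOt stO; apply: contrapT => gst.
pose e := mdist (g s) (g t) / 2.
have e0 : 0 < e by rewrite divr_gt0 // mdist_gt0; exact/eqP.
have [d1 d10 sd1] := continuous_mdist s e0.
have [d2 d20 td2] := continuous_mdist t e0.
(* The third ensures [s + d < t - d] and keeps points within [d] of [s] and [t] strictly inside the
   moduli [d1] and [d2]. *)
pose d := Num.min (t - s) (Num.min d1 d2) / 3.
have ts0 : 0 < t - s by rewrite subr_gt0.
have d0 : 0 < d by rewrite divr_gt0 // !lt_min ts0 d10.
have [dts dd1 dd2] : [/\ 3 * d <= t - s, 3 * d <= d1 & 3 * d <= d2].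
  have E : 3 * d = Num.min (t - s) (Num.min d1 d2) by rewrite /d; lra.
  by rewrite E !ge_min !lexx !orbT.
have [O FO dO] : exists2 O, F O & `[s + d, t - d] `<=` O.
  have [O1 FO1 _] : (\bigcup_(O in F) O) ((s + t) / 2).
    by apply: stO; rewrite /= in_itv /=; apply/andP; split; lra.
  pose FF := filter_from F (fun O => [set O' | F O' /\ O `<=` O']).
  have pFF : ProperFilter FF.
    apply: filter_from_proper => [|O FO]; last by exists O; split.
    apply: filter_from_filter; first by exists O1.
    move=> O O' FO FO'; have [OO'|O'O] := totF _ _ FO FO'.
    + by exists O' => // W [FW OW]; do 2!split=> //; exact: subset_trans OW.
    + by exists O => // W [FW OW]; do 2!split=> //; exact: subset_trans OW.
  have := @segment_compact R (s + d) (t - d).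
  move=> /compact_near_coveringP/(_ _ FF (fun O x => F O /\ O x)) H.
  have [|O' H'] := filter_ex (H _ _); last first.
    exists O'; last by move=> x /H'[].
    suff /H'[] : [set` `[s + d, t - d]] (s + d) by [].
    by rewrite /= in_itv /= lexx /=; lra.
  move=> x; rewrite /= in_itv /= => /andP[sx xt].
  have [O FO Ox] : (\bigcup_(O in F) O) x.
    by apply: stO; rewrite /= in_itv /=; apply/andP; split; lra.
  exists (O, [set O' | F O' /\ O `<=` O']); last first.
    by move=> [z W] [/= Oz [FW OW]]; split=> //; exact: OW.
  split; last by exists O.
  by apply: open_nbhs_nbhs; split=> //; have [] := Fc _ FO.
have [oO _ Og] := Fc _ FO.
have cO : closed (~` O) by exact: open_closedC.
have nO x : ~ (\bigcup_(O in F) O) x -> ~ O x by move=> nx Ox; apply: nx; exists O.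
have [s' [nOs' s's ms]] : exists m, [/\ ~ O m, m <= s + d &
    forall y, ~ O y -> y <= s + d -> y <= m].
  by apply: closed_max_le => //; exists s; [exact: nO|lra].
have [t' [nOt' t't mt]] : exists m, [/\ ~ O m, t - d <= m &
    forall y, ~ O y -> t - d <= y -> m <= y].
  by apply: closed_min_ge => //; exists t; [exact: nO|lra].
have ss' : s <= s' by apply: ms; [exact: nO|lra].
have tt' : t' <= t by apply: mt; [exact: nO|lra].
have gs't' : g s' = g t'.
  apply: Og => //; first lra.
  move=> x; rewrite /= in_itv /= => /andP[s'x xt'].
  apply: contrapT => nOx.
  have [xs|xs] := leP x (s + d); first by have := ms _ nOx xs; lra.
  have [tx|tx] := leP (t - d) x; first by have := mt _ nOx tx; lra.
  by apply: nOx; apply: dO; rewrite /= in_itv /=; lra.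
have h1 : mdist (g s) (g s') < e by apply: sd1; rewrite ger0_norm; lra.
have h2 : mdist (g t) (g t') < e by apply: td2; rewrite ler0_norm; lra.
have := metric_triangle (g s) (g s') (g t).
rewrite [in X in _ <= _ + X]metric_sym gs't' => h3; rewrite gs't' in h1.
have : mdist (g s) (g t) = e + e by rewrite /e -splitr.
lra.
Qed.

(* [g] induces an injective path on the complement of [O], once the two ends of
   each component of [O] are identified. *)
Lemma maximal_collapsible : exists O, collapsible O /\
  forall s t, ~ O s -> ~ O t -> 0 <= s -> s < t -> t <= T -> g s = g t ->
    `]s, t[ `<=` O.
Proof.
have [O [[oO OT Og] mO]] := Zorn_bigcup collapsible_bigcup.
exists O; split=> // s t nOs nOt s0 st tT gst; apply: contrapT => nst.
apply: (mO (O `|` `]s, t[)).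
  by split=> [x Ox|H]; [left|apply: nst => x stx; apply: H; right].
split.
- by apply: openU => //; exact: interval_open.
- move=> x [/OT//|]; rewrite /= !in_itv /= => /andP[sx xt].
  by apply/andP; split; lra.
move=> s1 t1 st1 n1 n2 sub.
have [nOs1 ns1] : ~ O s1 /\ ~ (s < s1 < t).
  by split=> H; apply: n1; [left|right; rewrite /= in_itv].
have [nOt1 nt1] : ~ O t1 /\ ~ (s < t1 < t).
  by split=> H; apply: n2; [left|right; rewrite /= in_itv].
have nst' x : s1 < x < t1 -> ~ O x -> s < x < t.
  by move=> x1 nOx; have [|//|] := sub x; rewrite /= in_itv.
(* As [s] and [t] are outside the enlarged set, its component []s1, t1[] either is []s, t[] or
   misses it and lies in [O]. *)
have hs : ~ (s1 < s < t1) by move=> /nst'/(_ nOs); rewrite ltxx.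
have ht : ~ (s1 < t < t1) by move=> /nst'/(_ nOt); rewrite ltxx andbF.
have [[s1s t1t]|H] := pselect (s1 = s /\ t1 = t); first by rewrite s1s t1t.
apply: Og => // x x1; have [//|] := sub x x1; move: x1.
rewrite /= !in_itv /= => /andP[s1x xt1] /andP[sx xt]; exfalso.
have ss1 : s <= s1 by rewrite leNgt; apply/negP => ?; apply: hs; apply/andP; split; lra.
have tt1 : t1 <= t by rewrite leNgt; apply/negP => ?; apply: ht; apply/andP; split; lra.
apply: H; split; apply/eqP; rewrite eq_le.
  by rewrite ss1 leNgt andbT; apply/negP => ?; apply: ns1; apply/andP; split; lra.
by rewrite tt1 leNgt; apply/negP => ?; apply: nt1; apply/andP; split; lra.
Qed.

(** The path [g] is frozen on the components of a maximal collapsible set [O]: [h t] is the value of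
    [g] at [l t], the last point off [O] up to [t]. By maximality, a value taken twice is kept in
    between. *)
Lemma light_path : exists h : R -> X,
  [/\ continuous h, h 0 = g 0, h T = g T,
      forall t, 0 <= t <= T -> exists2 s, 0 <= s <= T & h t = g s &
      forall r s t, 0 <= r -> r <= s -> s <= t -> t <= T -> h r = h t -> h s = h r].
Proof.
have [O [[oO OT Og] inj]] := maximal_collapsible.
have cO : closed (~` O) by exact: open_closedC.
have nO x : ~ (0 < x < T) -> ~ O x by move=> nx /OT; rewrite /= in_itv.
have nO0 : ~ O 0 by apply: nO; rewrite ltxx.
have nOT : ~ O T by apply: nO; rewrite ltxx andbF.
have /choice[l lP] : forall t, exists m, [/\ ~ O m, m <= t &
    forall y, ~ O y -> y <= t -> y <= m].
  move=> t; apply: closed_max_le => //; have [t0|t0] := leP 0 t; first by exists 0.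
  by exists t => //; apply: nO => /andP[]; lra.
have /choice[u uP] : forall t, exists m, [/\ ~ O m, t <= m &
    forall y, ~ O y -> t <= y -> m <= y].
  move=> t; apply: closed_min_ge => //; have [t0|t0] := leP t T; first by exists T.
  by exists t => //; apply: nO => /andP[]; lra.
have l_id t : ~ O t -> l t = t.
  move=> Ot; have [_ lt ml] := lP t; apply/eqP; rewrite eq_le lt /=; exact: ml.
have glu t : g (l t) = g (u t).
  have [[nl lt ml] [nu tu mu]] := (lP t, uP t).
  have [<-//|lu] := eqVneq (l t) (u t).
  apply: Og => //; first by rewrite lt_neqAle lu (le_trans lt).
  move=> x; rewrite /= in_itv /= => /andP[lx xu]; apply: contrapT => nx.
  have [xt|tx] := leP x t; first by have := ml _ nx xt; lra.
  by have := mu _ nx (ltW tx); lra.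
(* The function [l] jumps at the right ends of components; this replaces its continuity. *)
have between r t : r <= t -> g (l r) = g (l t) \/ exists x y,
    [/\ r <= x <= t, r <= y <= t, g (l r) = g x & g (l t) = g y].
  move=> rt; have [[[nlr lr mlr] [nlt lt mlt]] [nur ru mur]] := (lP r, lP t, uP r).
  have [rl|lr'] := leP r (l t); [right|left].
    exists (u r), (l t); split=> //; first by rewrite ru (le_trans (mur _ nlt rl)).
    by rewrite rl lt.
  congr g; apply/eqP; rewrite eq_le mlt //=; last lra.
  by apply: mlr => //; exact: ltW.
exists (g \o l); split=> /=; [|by rewrite l_id..| |].
- move=> t B /nbhs_ballP[e /= e0 tB].
  have e20 : 0 < e / 2 by rewrite divr_gt0.
  have [d d0 td] := continuous_mdist t e20.
  apply/nbhs_ballP; exists d => //= s; rewrite /ball /= => ts; apply: tB.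
  rewrite ballEmdist /=.
  have near x y : `|x - t| < d -> `|y - t| < d -> mdist (g x) (g y) < e.
    move=> /td tx /td ty; rewrite (le_lt_trans (metric_triangle _ (g t) _)) //.
    by rewrite metric_sym; lra.
  have [st|/ltW st] := leP t s.
    have tsd : s - t < d by move: ts; rewrite distrC ger0_norm // subr_ge0.
    have [->|[x [y [/andP[tx xs] /andP[ty ys] -> ->]]]] := between _ _ st.
      by rewrite mdistxx.
    by apply: near; rewrite ger0_norm ?subr_ge0 //; lra.
  have tsd : t - s < d by move: ts; rewrite ger0_norm // subr_ge0.
  have [->|[x [y [/andP[tx xs] /andP[ty ys] -> ->]]]] := between _ _ st.
    by rewrite mdistxx.
  by apply: near; rewrite ler0_norm ?subr_le0 //; lra.
- move=> t /andP[t0 tT]; have [nl lt ml] := lP t; exists (l t) => //.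
  by rewrite ml //= (le_trans lt).
move=> r s t r0 rs st tT grt.
have [[[nlr lr mlr] [nls ls mls]] [nlt lt mlt]] := (lP r, lP s, lP t).
have lrs : l r <= l s by apply: mls => //; lra.
have lst : l s <= l t by apply: mlt => //; lra.
have lr0 : 0 <= l r by apply: mlr.
have [lrt|lrt] := eqVneq (l r) (l t).
  by congr g; apply/eqP; rewrite eq_le lrs lrt lst.
have [->//|lsr] := eqVneq (l s) (l r).
have [->//|lst'] := eqVneq (l s) (l t).
have lrt' : l r < l t by rewrite lt_neqAle lrt (le_trans lrs).
(* The values of [g] at [l r] and [l t] agree, so [O] contains the interval between them, and [l s]
   with it. *)
case: nls; apply: (inj (l r) (l t) nlr nlt lr0 lrt') => //; first lra.
by rewrite /= in_itv /= !lt_neqAle lrs lst eq_sym lsr lst'.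
Qed.

End collapse.

(** * Sums with geometric weights *)

Section weighted_sum.
Context {R : realType}.
Implicit Types (u v : nat -> R) (c : R).

Definition wpartial u n : R := \sum_(k < n) u k / 2 ^+ k.+1.

Definition wsum u : R := sup (range (wpartial u)).

Definition unit_seq u := forall k, 0 <= u k <= 1.

Lemma wpartial_le u v c n : (forall k, u k <= v k + c) ->
  wpartial u n <= wpartial v n + c * (1 - 2 ^- n).
Proof.
move=> uv; elim: n => [|n IH].
  by rewrite /wpartial !big_ord0 expr0 invr1 subrr mulr0 addr0.
rewrite /wpartial !big_ord_recr /= -!/(wpartial _ _).
have p0 : 0 < (2 ^- n.+1 : R) by rewrite invr_gt0 exprn_gt0.
have E : (2 ^- n : R) = 2 * 2 ^- n.+1.
  by rewrite exprS invfM mulrA mulfV ?mul1r // pnatr_eq0.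
have := ler_wpM2r (ltW p0) (uv n).
by rewrite E in IH; rewrite mulrDl; move: IH; lra.
Qed.

Lemma pow2V_ge0 n : 0 <= 2 ^- n :> R.
Proof. by rewrite invr_ge0 exprn_ge0. Qed.

Lemma wpartial_mono u n m : unit_seq u -> (n <= m)%N -> wpartial u n <= wpartial u m.
Proof.
move=> u01; elim: m => [|m IH]; first by rewrite leqn0 => /eqP ->.
rewrite leq_eqVlt => /orP[/eqP ->//|/IH nm]; apply: le_trans nm _.
rewrite /wpartial big_ord_recr /= lerDl mulr_ge0 ?pow2V_ge0 //.
by have /andP[] := u01 m.
Qed.

Lemma wpartial_ubound u : unit_seq u -> has_ubound (range (wpartial u)).
Proof.
move=> u01; exists 1 => _ [n _ <-].
have u1 k : u k <= 0 + 1 by rewrite add0r; have /andP[] := u01 k.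
apply: le_trans (@wpartial_le u (fun=> 0) 1 n u1) _.
have -> : wpartial (fun=> 0) n = 0.
  by rewrite /wpartial big1 // => k _; rewrite mul0r.
by rewrite add0r mul1r lerBlDr lerDl pow2V_ge0.
Qed.

Lemma wpartial_wsum u n : unit_seq u -> wpartial u n <= wsum u.
Proof. by move=> u01; apply: ub_le_sup; [exact: wpartial_ubound|exists n]. Qed.

Lemma wsum_le u v c : unit_seq v -> 0 <= c -> (forall k, u k <= v k + c) ->
  wsum u <= wsum v + c.
Proof.
move=> v01 c0 uv; apply: ge_sup; first by exists (wpartial u 0), 0%N.
move=> _ [n _ <-]; apply: le_trans (wpartial_le n uv) _.
apply: lerD; first exact: wpartial_wsum.
by rewrite -[leRHS]mulr1 ler_wpM2l // lerBlDr lerDl pow2V_ge0.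
Qed.

Lemma wsum_lt u v k0 : unit_seq u -> unit_seq v -> (forall k, u k <= v k) ->
  u k0 < v k0 -> wsum u < wsum v.
Proof.
move=> u01 v01 uv uvk.
pose c := (v k0 - u k0) / 2 ^+ k0.+1.
have c0 : 0 < c by rewrite divr_gt0 ?exprn_gt0 // subr_gt0.
suff : wsum u <= wsum v - c by lra.
apply: ge_sup; first by exists (wpartial u 0), 0%N.
move=> _ [n _ <-].
have [m [nm km]] : exists m, (n <= m)%N /\ (k0 < m)%N.
  by exists (maxn n k0.+1); rewrite leq_maxl leq_maxr.
apply: le_trans (wpartial_mono u01 nm) _.
rewrite lerBrDr; apply: le_trans (wpartial_wsum m v01).
rewrite /wpartial (bigD1 (Ordinal km)) //= [leRHS](bigD1 (Ordinal km)) //=.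
rewrite addrAC lerD //; first by rewrite /c -mulrDl addrC subrK.
by apply: ler_sum => k _; rewrite ler_wpM2r ?pow2V_ge0.
Qed.

End weighted_sum.

(** * A monotone function detecting the moves of a path *)

Section light_path_height.
Context {R : realType} {X : metricType R} (h : R -> X) (ch : continuous h).

Let D q s : R := Num.min 1 (mdist (h q) (h s)).

(** The added [0] fixes the value before time [q], where no [s] is available; the cap in [D] makes
    these functions summable with the weights. *)
Definition spread q t : R := sup (0 |` [set D q s | s in [set s | q <= s <= t]]).

Let D01 q s : 0 <= D q s <= 1.
Proof. by rewrite /D le_min mdist_ge0 ler01 ge_min lexx. Qed.

Let spread_ub q t : has_ubound (0 |` [set D q s | s in [set s | q <= s <= t]]).
Proof. by exists 1 => _ [->//|[s _ <-]]; have /andP[] := D01 q s. Qed.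

Let spread_le q t c : 0 <= c -> (forall s, q <= s <= t -> D q s <= c) ->
  spread q t <= c.
Proof.
move=> c0 H; apply: ge_sup; first by exists 0; left.
by move=> _ [->//|[s st <-]]; exact: H.
Qed.

Lemma spread_ge q s t : q <= s <= t -> D q s <= spread q t.
Proof. by move=> st; apply: ub_le_sup => //; right; exists s. Qed.

Lemma spread_ge0 q t : 0 <= spread q t.
Proof. by apply: ub_le_sup => //; left. Qed.

Lemma spread01 q t : 0 <= spread q t <= 1.
Proof.
rewrite spread_ge0; apply: spread_le => // s _.
by have /andP[] := D01 q s.
Qed.

Lemma spread_lt q t : t < q -> spread q t = 0.
Proof.
move=> tq; apply/eqP; rewrite eq_le spread_ge0 andbT.
by apply: spread_le => // s /andP[qs st]; lra.
Qed.

Lemma spread_mono q t t' : t <= t' -> spread q t <= spread q t'.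
Proof.
move=> tt'; apply: spread_le; first exact: spread_ge0.
by move=> s /andP[qs st]; apply: spread_ge; rewrite qs (le_trans st).
Qed.

Lemma spread_osc q t t' e : 0 <= e ->
  (forall s, t <= s <= t' -> mdist (h t) (h s) <= e) ->
  spread q t' <= spread q t + 2 * e.
Proof.
move=> e0 osc; have sp0 := spread_ge0 q t.
apply: spread_le => [|s /andP[qs st']]; first lra.
have [st|/ltW ts] := leP s t.
  by have := @spread_ge q s t; rewrite qs st => /(_ isT); lra.
have hts : mdist (h t) (h s) <= e by apply: osc; rewrite ts.
have [qt|/ltW tq] := leP q t.
  have := @spread_ge q t t; rewrite qt lexx => /(_ isT).
  have := metric_triangle (h q) (h t) (h s).
  by rewrite /D ge_min ge_min => tri /orP[h1|h2]; apply/orP; [left|right]; lra.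
have htq : mdist (h t) (h q) <= e by apply: osc; rewrite tq (le_trans qs).
have := metric_triangle (h q) (h t) (h s); rewrite (metric_sym (h q) (h t)).
by rewrite /D ge_min => tri; apply/orP; right; lra.
Qed.

(* Strictly increasing except where [h] is constant: each rational [q] detects a
   move of [h] after time [q]. *)
Definition height t : R :=
  wsum (fun k => spread (ratr (odflt 0 (@choice.unpickle rat k))) t).

Lemma height_mono t t' : t <= t' -> height t <= height t'.
Proof.
move=> tt'; rewrite -[leRHS]addr0; apply: wsum_le => // k; first exact: spread01.
by rewrite addr0; exact: spread_mono.
Qed.

Lemma height_osc t t' e : 0 <= e ->
  (forall s, t <= s <= t' -> mdist (h t) (h s) <= e) ->
  height t' <= height t + 2 * e.
Proof.
move=> e0 osc; apply: wsum_le => [k||k]; [exact: spread01|lra|exact: spread_osc].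
Qed.

Lemma height_continuous : continuous height.
Proof.
move=> t B /nbhs_ballP[e /= e0 tB].
(* To the left of [t] the oscillation is measured from [s] through [t], which costs [4 * (e / 5)] in
   all. *)
have e20 : 0 < e / 5 by rewrite divr_gt0.
have /nbhs_ballP[d /= d0 td] := ch (nbhsx_ballx (h t) _ e20).
apply/nbhs_ballP; exists d => //= s; rewrite /ball /= => ts; apply: tB.
have near x : `|t - x| < d -> mdist (h t) (h x) < e / 5.
  by move=> tx; have := td x tx; rewrite /= ballEmdist.
rewrite /ball /=; have [st|/ltW st] := leP t s.
  have hm := height_mono st.
  have : height s <= height t + 2 * (e / 5).
    apply: height_osc => [|x /andP[tx xs]]; first lra.
    apply/ltW/near; move: ts; rewrite !ler0_norm ?subr_le0 //; lra.
  by rewrite ler0_norm ?subr_le0 //; lra.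
have hm := height_mono st.
have : height t <= height s + 2 * (e / 5 + e / 5).
  apply: height_osc => [|x /andP[sx xt]]; first lra.
  apply: le_trans (metric_triangle _ (h t) _) _.
  rewrite metric_sym; apply/ltW/ltrD; first exact: near.
  by apply: near; move: ts; rewrite !ger0_norm ?subr_ge0 //; lra.
by rewrite ger0_norm ?subr_ge0 //; lra.
Qed.

Lemma height_eq t t' : (forall s, t <= s <= t' -> h s = h t) -> t <= t' ->
  height t = height t'.
Proof.
move=> htt' tt'; apply/eqP; rewrite eq_le height_mono //=.
have := @height_osc t t' 0; rewrite mulr0 addr0; apply=> // s st.
by rewrite htt' // mdistxx.
Qed.

(** A rational [q] just after [t] still has [h q <> h t'], so its spread vanishes at [t] and is
    positive at [t']. *)
Lemma height_lt t t' : t < t' -> h t <> h t' -> height t < height t'.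
Proof.
move=> tt' htt'.
have d0 : 0 < mdist (h t) (h t') by rewrite mdist_gt0; exact/eqP.
have /nbhs_ballP[d /= d0' td] := ch (nbhsx_ballx (h t) _ d0).
have [q] : exists q : rat, ratr q \in `]t, Num.min t' (t + d)[.
  by apply: rat_in_itvoo; rewrite lt_min tt' ltrDl.
rewrite in_itv /= lt_min => /andP[tq /andP[qt' qd]].
apply: (@wsum_lt _ _ _ (choice.pickle q)); [move=> k..|].
- exact: spread01.
- exact: spread01.
- exact/spread_mono/ltW.
rewrite choice.pickleK /= spread_lt //.
apply: lt_le_trans (@spread_ge _ t' t' _); last by rewrite ltW // lexx.
rewrite /D lt_min ltr01 /= mdist_gt0; apply/eqP => hq.
have : ball (h t) (mdist (h t) (h t')) (h (ratr q)).
  by apply: td; rewrite /ball /= ler0_norm ?subr_le0; lra.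
by rewrite ballEmdist /= hq ltxx.
Qed.

End light_path_height.

(* [p] is a quotient map onto its image. *)
Lemma within_continuous_factor (S Y Z : topologicalType) (K : set S)
    (p : S -> Y) (k : S -> Z) (q : Y -> Z) : hausdorff_space Y -> compact K ->
  {within K, continuous p} -> {within K, continuous k} ->
  (forall s, K s -> q (p s) = k s) -> {within p @` K, continuous q}.
Proof.
move=> hY cK /subspace_continuousP cp /subspace_continuousP ck qpk.
apply/subspace_continuousP => _ [s0 Ks0 <-] V Vq.
have Vk : nbhs (k s0) V by rewrite -qpk.
have /near_covering_withinP : near_covering K.
  exact/compact_near_coveringP.
move=> /(_ _ (nbhs (p s0)) (fun y s => p s = y -> V (k s))) H.
have {}H : \forall y \near p s0, K `<=` (fun s => p s = y -> V (k s)).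
  apply: H => s Ks; have [pss0|pss0] := pselect (p s = p s0).
    exists ([set s' | K s' -> V (k s')], setT); last first.
      by move=> [s' y] [/= KV _] Ks' _; exact: KV.
    split; last exact: filterT.
    have Vs : nbhs (k s) V by rewrite -qpk // pss0 qpk.
    exact: (ck s Ks V Vs).
  have := hY; rewrite open_hausdorff => /(_ _ _ (introN eqP pss0)).
  move=> [[A B] /= [/set_mem As /set_mem Bs0] [oA oB AB]].
  exists ([set s' | K s' -> A (p s')], B).
    split; last by apply: open_nbhs_nbhs.
    have As' : nbhs (p s) A by exact: open_nbhs_nbhs.
    exact: (cp s Ks A As').
  move=> [s' y] [/= KA By] /KA + ps'y; rewrite ps'y => Ay.
  by have : (A `&` B) y by []; rewrite (eqP AB).
apply: filterS H => y Hy [s Ks psy].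
by have := Hy s Ks psy; rewrite -qpk // psy.
Qed.

(** * Arcs with an injective coordinate *)

Section arcs.
Context {R : realType} {X : metricType R}.

(* An arc is given by an injective coordinate [phi] on it rather than by a
   parametrization. *)
Record is_arc (A : set X) (phi : X -> R) (a b : X) : Prop := IsArc {
  arc_compact : compact A;
  arc_connected : connected A;
  arc_continuous : {within A, continuous phi};
  arc_inj : forall x y, A x -> A y -> phi x = phi y -> x = y;
  arc_left : A a;
  arc_right : A b;
  arc_range : forall x, A x -> phi a <= phi x <= phi b }.

Hypotheses (cX : compact [set: X]) (lcX : locally_connected X).

(** A light path is constant between two times spent at the same point. So its height depends on the
    point only, whichever time [s x] is selected, and is an injective coordinate on the image. *)
Lemma arc_exists U a b : open U -> connected U -> U a -> U b -> a <> b ->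
  exists A phi, A `<=` U /\ is_arc A phi a b.
Proof.
move=> oU cU Ua Ub ab; have [g [l [cg gU g0 gl]]] := path_exists cX lcX oU cU Ua Ub.
have l0 : 0 < l%:R :> R.
  by rewrite ltr0n lt0n; apply/eqP => l0; apply: ab; rewrite -g0 -gl l0.
have [h [ch h0 hl hg hlight]] := light_path cg l%:R.
set T : R := l%:R in l0 gl hl hg hlight.
pose A := h @` `[0, T].
have chT : {within `[0, T], continuous h} by exact: continuous_subspaceT.
have cT : compact `[0, T] by exact: segment_compact.
have /choice[s sP] : forall x, exists t, A x -> 0 <= t <= T /\ h t = x.
  move=> x; have [[t + <-]|nAx] := pselect (A x); last by exists 0.
  by rewrite /= in_itv /= => tT; exists t.
have hsE t : 0 <= t <= T -> height h (s (h t)) = height h t.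
  move=> /andP[t0 tT].
  have [|/andP[s0 sT] hs] := sP (h t); first by exists t; rewrite //= in_itv /= t0.
  have [ts|/ltW ts] := leP t (s (h t)).
    symmetry; apply: height_eq => // x /andP[tx xs].
    by apply: (hlight t x (s (h t))).
  apply: height_eq => // x /andP[sx xt].
  by apply: (hlight (s (h t)) x t).
have hA t : 0 <= t <= T -> A (h t) by move=> tT; exists t; rewrite //= in_itv.
have T0 : 0 <= T <= T by rewrite lexx ltW.
have O0 : 0 <= (0 : R) <= T by rewrite lexx ltW.
exists A, (height h \o s); split.
  by move=> _ [t + <-]; rewrite /= in_itv /= => /hg[r _ ->]; exact: gU.
split.
- exact: continuous_compact.
- by apply: connected_continuous_connected => //; exact: segment_connected.
- have hsE' t : `[0, T]%classic t -> (height h \o s) (h t) = height h t.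
    by rewrite /= in_itv /=; exact: hsE.
  apply: within_continuous_factor cT chT _ hsE'; first exact: metric_hausdorff.
  exact/continuous_subspaceT/height_continuous.
- move=> x y /sP[/andP[sx0 sxT] <-] /sP[/andP[sy0 syT] <-].
  move: (s x) (s y) sx0 sxT sy0 syT => r t r0 rT t0 tT.
  rewrite /= !hsE ?r0 ?t0 // => hrt; apply: contrapT => nrt.
  have [rt|tr|rt] := ltgtP r t; last by apply: nrt; rewrite rt.
  + by have := height_lt ch rt nrt; rewrite hrt ltxx.
  + by have := height_lt ch tr (nesym nrt); rewrite hrt ltxx.
- by rewrite -g0 -h0; exact: hA.
- by rewrite -gl -hl; exact: hA.
- move=> _ [t + <-]; rewrite /= in_itv /= -g0 -h0 -gl -hl => tT.
  by rewrite !hsE // !height_mono //; have /andP[] := tT.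
Qed.

End arcs.

(** * Circles made of two arcs *)

Section circles.
Context {R : realType} {X : metricType R}.
Implicit Types (A B : set X).

Let hX : hausdorff_space X := metric_hausdorff (T := X).

(** The coordinate is normalised to the range of the abscissa on the unit circle, so that two such
    arcs can be laid on its upper and lower halves. *)
Record coord_arc A (c : X -> R) (u v : X) : Prop := CoordArc {
  coord_compact : compact A;
  coord_continuous : {within A, continuous c};
  coord_inj : forall x y, A x -> A y -> c x = c y -> x = y;
  coord_range : forall x, A x -> -1 <= c x <= 1;
  coord_surj : forall r, -1 <= r <= 1 -> exists2 x, A x & c x = r;
  coord_left : A u /\ c u = -1;
  coord_right : A v /\ c v = 1 }.

(** The affine change of coordinate works whichever of [phi u] and [phi v] is larger; surjectivity
    comes from the connectedness of [A]. *)
Lemma subarc A phi a b u v : is_arc A phi a b -> A u -> A v -> u <> v ->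
  let c x := (phi x - phi u) / (phi v - phi u) * 2 - 1 in
  coord_arc (A `&` [set x | -1 <= c x <= 1]) c u v.
Proof.
move=> aA Au Av uv c; set B := A `&` _.
have nuv : phi v - phi u != 0.
  by rewrite subr_eq0; apply/eqP => /(arc_inj aA Av Au)/esym.
have cu : c u = -1 by rewrite /c subrr mul0r mul0r add0r.
have cv : c v = 1 by rewrite /c divff // mul1r; lra.
have ccA : {within A, continuous c}.
  have /subspace_continuousP cphi := arc_continuous aA.
  apply/subspace_continuousP => x /cphi cx.
  apply: cvgB; last exact: cvg_cst.
  apply: cvgM; last exact: cvg_cst.
  apply: cvgM; last exact: cvg_cst.
  by apply: cvgB; last exact: cvg_cst.
have subBA : B `<=` A by exact: subIsetl.
split.
- have cA := compact_closed hX (arc_compact aA).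
  have ccl : closed ((c : subspace A -> R) @^-1` `[-1, 1]).
    by move/continuous_closedP : ccA; apply; exact: interval_closed.
  apply: (subclosed_compact _ (arc_compact aA) subBA).
  have -> : B = A `&` (c @^-1` `[-1, 1]).
    by apply/seteqP; split=> x [Ax]; rewrite /= ?in_itv.
  by rewrite (closed_setSI _ cA).
- exact: continuous_subspaceW subBA ccA.
- move=> x y [Ax _] [Ay _]; rewrite /c => /addIr /mulIf H.
  have /mulIf H1 : (phi x - phi u) / (phi v - phi u) =
      (phi y - phi u) / (phi v - phi u).
    by apply: H; rewrite pnatr_eq0.
  apply: (arc_inj aA Ax Ay); apply: (@addIr _ (- phi u)).
  by apply: H1; rewrite invr_eq0.
- by move=> x [].
- move=> r r1; have /connected_intervalP itvA :=
    connected_continuous_connected (arc_connected aA) ccA.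
  have [||x Ax cx] := itvA (-1) 1 _ _ r r1.
  + by exists u.
  + by exists v.
  + by exists x => //; split=> //=; rewrite cx.
- by split=> //; split=> //=; rewrite cu lexx; lra.
- by split=> //; split=> //=; rewrite cv lexx; lra.
Qed.

Let arch (s r : R) : R * R := (r, s * Num.sqrt (1 - r ^+ 2)).

Let arch_continuous s : continuous (arch s).
Proof.
move=> r.
apply: (@cvg_pair _ _ _ (nbhs r) (nbhs r) (nbhs (s * Num.sqrt (1 - r ^+ 2)))).
  exact: cvg_id.
apply: cvgM; first exact: cvg_cst.
apply: (@cvg_comp _ _ _ (fun r => 1 - r ^+ 2) Num.sqrt _ (nbhs (1 - r ^+ 2))).
  by apply: cvgB; [exact: cvg_cst|exact: exprn_continuous].
exact: sqrt_continuous.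
Qed.

Let sqr_le1 (r : R) : -1 <= r <= 1 -> 0 <= 1 - r ^+ 2.
Proof. by move=> /andP[r1 r2]; rewrite subr_ge0 expr2; nra. Qed.

Let arch_circle s r : s ^+ 2 = 1 -> -1 <= r <= 1 -> circle (arch s r).
Proof.
move=> s1 /sqr_le1 r1; rewrite /circle /arch /= exprMn s1 mul1r sqr_sqrtr //.
by rewrite addrC subrK.
Qed.

Let arch_ends s r : r = 1 \/ r = -1 -> arch s r = (r, 0).
Proof. by rewrite /arch => -[->|->]; rewrite ?sqrrN expr1n subrr sqrtr0 mulr0. Qed.

(** [A] is laid on the upper half of the circle and [B] on the lower half; the two maps agree at the
    common points [u] and [v]. The inverse is continuous because the domain is compact. *)
Lemma circle_of_arcs A B cA cB u v : coord_arc A cA u v -> coord_arc B cB u v ->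
  (forall x, A x -> B x -> x = u \/ x = v) -> simple_closed_curve R (A `|` B).
Proof.
move=> aA aB AB.
have [[Au cAu] [Av cAv]] := (coord_left aA, coord_right aA).
have [[Bu cBu] [Bv cBv]] := (coord_left aB, coord_right aB).
have /choice[gA gAP] : forall r, exists x, -1 <= r <= 1 -> A x /\ cA x = r.
  move=> r; have [/(coord_surj aA)[x Ax cx]|nr] := pselect (-1 <= r <= 1).
    by exists x.
  by exists u.
have /choice[gB gBP] : forall r, exists x, -1 <= r <= 1 -> B x /\ cB x = r.
  move=> r; have [/(coord_surj aB)[x Bx cx]|nr] := pselect (-1 <= r <= 1).
    by exists x.
  by exists u.
pose h x : R * R := if `[< A x >] then arch 1 (cA x) else arch (-1) (cB x).
pose g (p : R * R) := if 0 <= p.2 then gA p.1 else gB p.1.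
have hA x : A x -> h x = arch 1 (cA x) by move=> Ax; rewrite /h asboolT.
have hB x : B x -> h x = arch (-1) (cB x).
  move=> Bx; rewrite /h; case: asboolP => // Ax.
  have [->|->] := AB _ Ax Bx; rewrite ?cAu ?cBu ?cAv ?cBv !arch_ends //; tauto.
have gh x : (A `|` B) x -> g (h x) = x.
  have gA' y : A y -> g (h y) = y.
    move=> Ay; rewrite hA // /g /= mul1r sqrtr_ge0.
    have [Ag cg] := gAP _ (coord_range aA Ay).
    exact: (coord_inj aA).
  move=> [/gA'//|Bx]; have [/gA'//|nAx] := pselect (A x).
  have r1 := coord_range aB Bx.
  rewrite hB // /g /= mulN1r oppr_ge0 leNgt sqrtr_gt0 subr_gt0.
  have [Bg cg] := gBP _ r1.
  case: ifP => [|_]; last exact: (coord_inj aB).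
  (* A point of [B] sent to the closed upper half has coordinate [-1] or [1], so it is an end and
     belongs to [A]. *)
  rewrite -leNgt => c1; exfalso; apply: nAx.
  have /eqP : cB x ^+ 2 = 1.
    by apply/eqP; rewrite eq_le c1 andbT -subr_ge0 sqr_le1.
  rewrite sqrf_eq1 => /orP[/eqP c|/eqP c].
    by have -> : x = v by apply: (coord_inj aB) => //; rewrite c.
  by have -> : x = u by apply: (coord_inj aB) => //; rewrite c.
have hC x : (A `|` B) x -> circle (h x).
  move=> [Ax|Bx].
    by rewrite hA //; apply: arch_circle (coord_range aA Ax); rewrite expr1n.
  by rewrite hB //; apply: arch_circle (coord_range aB Bx); rewrite sqrrN expr1n.
have hsurj : h @` (A `|` B) = @circle R.
  apply/seteqP; split=> [_ [x Cx <-]|[r s]]; first exact: hC.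
  rewrite /circle /= => rs.
  have r1 : -1 <= r <= 1 by apply/andP; split; nra.
  have es : 1 - r ^+ 2 = s ^+ 2 by lra.
  have [s0|s0] := leP 0 s.
    have [Ag cg] := gAP _ r1; exists (gA r); first by left.
    by rewrite hA // cg /arch es sqrtr_sqr ger0_norm // mul1r.
  have [Bg cg] := gBP _ r1; exists (gB r); first by right.
  by rewrite hB // cg /arch es sqrtr_sqr ltr0_norm // mulN1r opprK.
have ch : {within A `|` B, continuous h}.
  apply: withinU_continuous.
  - exact: compact_closed hX (coord_compact aA).
  - exact: compact_closed hX (coord_compact aB).
  - apply: (@subspace_eq_continuous _ _ _ (arch 1 \o cA)).
      by move=> x /set_mem /hA/esym.
    have /subspace_continuousP cc := coord_continuous aA.
    apply/subspace_continuousP => x /cc cx; apply: cvg_comp cx _.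
    exact: arch_continuous.
  - apply: (@subspace_eq_continuous _ _ _ (arch (-1) \o cB)).
      by move=> x /set_mem /hB/esym.
    have /subspace_continuousP cc := coord_continuous aB.
    apply/subspace_continuousP => x /cc cx; apply: cvg_comp cx _.
    exact: arch_continuous.
have cC : compact (A `|` B).
  by apply: compactU; [exact: (coord_compact aA)|exact: (coord_compact aB)].
exists g, h; split; [split|split=> //].
- by rewrite -hsurj => _ [_ [x Cx <-] <-]; rewrite gh.
- by rewrite hsurj.
- move=> p /set_mem; rewrite -hsurj => -[x Cx <-]; by rewrite gh.
- by move=> x /set_mem /gh.
- rewrite -hsurj; apply: (within_continuous_factor _ cC ch _ gh).
    exact: norm_hausdorff.
  by apply: continuous_subspaceT => x; exact: cvg_id.
Qed.

End circles.

(** * Betweenness and arcs in the absence of circles *)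

Section arcs_without_circles.
Context {R : realType} {X : metricType R}.
Hypotheses (cX : compact [set: X]) (lcX : locally_connected X).
Hypothesis nocircle : ~ exists C : set X, simple_closed_curve R C.

Let hX : hausdorff_space X := metric_hausdorff (T := X).

(* If [z] on the arc [A] does not separate its ends, then some arc [B] joins
   them off [z]; the closest points of [A] meeting [B] on both sides of [z]
   bound a circle in the union of [A] and [B]. *)
Lemma arc_btw (A : set X) (phi : X -> R) a b : is_arc A phi a b -> a <> b ->
  A `<=` btw a b.
Proof.
move=> aA ab z Az; apply: contrapT => abz.
have [B [psi [BU aB]]] := arc_exists cX lcX (branch_open hX lcX z a)
  (@branch_connected _ z a) (nbtw_refl (nbtw_neql abz)) abz ab.
have nBz : ~ B z by move=> /BU; exact: nbtw_notin.
pose S := phi @` (A `&` B).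
have cS : closed S.
  apply: compact_closed => //; apply: continuous_compact.
    exact: continuous_subspaceW (@subIsetl _ _ _) (arc_continuous aA).
  exact: compact_closedI (arc_compact aA) (compact_closed hX (arc_compact aB)).
have /andP[az zb] := arc_range aA Az.
have [|_ [[s [As Bs] <-] sz smax]] := @closed_max_le _ S (phi z) cS.
  exists (phi a) => //; exists a => //.
  by split; [exact: arc_left aA|exact: arc_left aB].
have [|_ [[t [At Bt] <-] zt tmin]] := @closed_min_ge _ S (phi z) cS.
  exists (phi b) => //; exists b => //.
  by split; [exact: arc_right aA|exact: arc_right aB].
have st : s <> t.
  move=> st; apply: nBz; have -> // : z = s.
  by apply: (arc_inj aA) => //; apply/eqP; rewrite eq_le sz andbT st zt.
have st0 : 0 < phi t - phi s.
  rewrite subr_gt0 lt_neqAle (le_trans sz zt) andbT.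
  by apply/eqP => /(arc_inj aA As At).
apply: nocircle; eexists.
apply: (circle_of_arcs (subarc aA As At st) (subarc aB Bs Bt st)).
move=> x [Ax /=] /andP[x1 x2] [Bx _].
have Sx : S (phi x) by exists x.
have sx : phi s <= phi x.
  have : 0 <= (phi x - phi s) / (phi t - phi s) by lra.
  by rewrite pmulr_lge0 ?invr_gt0 // subr_ge0.
have xt : phi x <= phi t.
  have : (phi x - phi s) / (phi t - phi s) <= 1 by lra.
  by rewrite ler_pdivrMr // mul1r; lra.
have [xz|/ltW zx] := leP (phi x) (phi z).
  by left; apply: (arc_inj aA) => //; apply/eqP; rewrite eq_le sx smax.
by right; apply: (arc_inj aA) => //; apply/eqP; rewrite eq_le xt tmin.
Qed.

Hypothesis connX : connected [set: X].

(** Otherwise [z] would be isolated in an arc from [z] to [u], whose points all lie in [btw z u];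
    but an arc is connected. *)
Lemma btw_acc (z u : X) (W : set X) : z <> u -> nbhs z W ->
  exists2 w, W w & w <> z /\ btw z u w.
Proof.
move=> zu; rewrite nbhsE => -[V [oV Vz] VW].
have [A [phi [_ aA]]] := arc_exists cX lcX openT connX (I : setT z) (I : setT u) zu.
apply: contrapT => H.
have Az := arc_left aA; have Au := arc_right aA.
suff E : [set z] = A by move: Au; rewrite -E => uz; apply: zu.
apply: (arc_connected aA); first by exists z.
- exists V => //; apply/seteqP; split=> [_ ->//|w [Aw Vw]].
  apply: contrapT => wz; apply: H; exists w; first exact: VW.
  by split=> //; apply: arc_btw aA zu _ Aw.
- exists [set z]; last by apply/seteqP; split=> [_ ->//|w []].
  by apply: accessible_closed_set1; exact: hausdorff_accessible.
Qed.

End arcs_without_circles.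

(** * Minimal sets *)

Lemma compact_seq_cover (T : topologicalType) (K : set T) (U : T -> set T) :
  compact K -> (forall x, K x -> nbhs x (U x)) ->
  exists2 s : seq T, (forall x, x \in s -> K x) &
    forall y, K y -> exists2 x, x \in s & U x y.
Proof.
rewrite compact_near_coveringP => cK KU.
pose F : set_system (seq T) :=
  filter_from setT (fun s : seq T => [set t : seq T | {subset s <= t}]).
have FF : ProperFilter F.
  apply: filter_from_proper => [|s _]; last by exists s.
  apply: filter_fromT_filter; first by exists [::].
  move=> s t; exists (s ++ t) => u /= stu.
  by split=> x xs; apply: stu; rewrite mem_cat xs ?orbT.
have [|s /= sP] := filter_ex (cK _ F
    (fun s y => exists2 x, x \in s & K x /\ U x y) _ _).
  move=> x Kx; exists (U x, [set t | x \in t]) => [|[y t] [/= Uy xt]].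
    split; first exact: KU.
    by exists [:: x] => // t xt; apply: xt; rewrite inE.
  by exists x.
exists [seq x <- s | `[<K x>]] => [x|y /sP[x xs [Kx Uxy]]].
  by rewrite mem_filter => /andP[/asboolP].
by exists x => //; rewrite mem_filter xs andbT; exact/asboolP.
Qed.

Section minimal_sets.
Context {T : topologicalType}.
Implicit Types (f : T -> T) (L M N K U : set T).

Lemma closed_invariant_iter f M n x :
  closed_invariant f M -> M x -> M (iter n f x).
Proof.
by move=> [_ _ fM] Mx; elim: n => //= n IH; apply: fM; exists (iter n f x).
Qed.

Lemma minimal_iter f M n x : minimal_set f M -> M x -> M (iter n f x).
Proof. by move=> [iM _]; exact: closed_invariant_iter. Qed.

Lemma minimal_closed f M : minimal_set f M -> closed M.
Proof. by case=> -[]. Qed.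

Lemma minimal_neq0 f M : minimal_set f M -> M !=set0.
Proof. by case=> -[]. Qed.

Lemma minimal_meet f L M : minimal_set f L -> minimal_set f M ->
  L `&` M !=set0 -> L = M.
Proof.
move=> [[L0 cL fL] mL] [[M0 cM fM] mM] LM.
have iLM : closed_invariant f (L `&` M).
  split=> //; first exact: closedI.
  by move=> _ [x [Lx Mx] <-]; split; [apply: fL|apply: fM]; exists x.
by rewrite -(mL _ iLM (@subIsetl _ _ _)) -[RHS](mM _ iLM (@subIsetr _ _ _)).
Qed.

(** The closure of the orbit of [x] is closed and invariant, so it is all of [M]. *)
Lemma minimal_return f M U x : continuous f -> minimal_set f M ->
  open U -> M `&` U !=set0 -> M x -> exists n, U (iter n f x).
Proof.
move=> cf [iM mM] oU [u [Mu Uu]] Mx.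
pose S := [set iter n f x | n in setT].
have SM : closure S `<=` M.
  have [_ /closure_id -> _] := iM.
  by apply: closure_subset => _ [n _ <-]; exact: closed_invariant_iter.
have iS : closed_invariant f (closure S).
  split; [|exact: closed_closure|].
    by exists x; apply: subset_closure; exists 0%N.
  move=> _ [w clw <-] B /cf /clw[_ [[n _ <-] Bn]].
  by exists (iter n.+1 f x); split=> //; exists n.+1.
move: Mu; rewrite -(mM _ iS SM) => /(_ U (open_nbhs_nbhs (conj oU Uu))).
by move=> [_ [[n _ <-] Un]]; exists n.
Qed.

Lemma minimal_intro f M : closed_invariant f M ->
  (forall x U, M x -> open U -> M `&` U !=set0 -> exists n, U (iter n f x)) ->
  minimal_set f M.
Proof.
move=> iM rM; split=> // N iN NM; apply/seteqP; split=> // y My.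
have [[w Nw] cN _] := iN; apply: cN => B.
rewrite nbhsE => -[U [oU Uy] UB].
have [|n Un] := rM w U (NM _ Nw) oU; first by exists y.
by exists (iter n f w); split; [exact: closed_invariant_iter|exact: UB].
Qed.

Hypothesis hT : hausdorff_space T.

Lemma minimal_fixed f M p : minimal_set f M -> f p = p -> M p -> M = [set p].
Proof.
move=> [_ mM] fp Mp; symmetry; apply: mM; last by move=> _ ->.
split; first by exists p.
- by apply: accessible_closed_set1; exact: hausdorff_accessible.
- by move=> _ [_ -> <-].
Qed.

Hypothesis cT : compact [set: T].

Lemma closed_compactT N : closed N -> compact N.
Proof. by move=> cN; apply: subclosed_compact cN cT _. Qed.

Lemma image_closed f N : continuous f -> closed N -> closed (f @` N).
Proof.
move=> cf cN; apply: compact_closed => //; apply: continuous_compact.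
  exact: continuous_subspaceT.
exact: closed_compactT.
Qed.

Lemma minimal_image f M : continuous f -> minimal_set f M -> f @` M = M.
Proof.
move=> cf [[M0 cM fM] mM]; apply: mM => //; split.
- exact: image_nonempty.
- exact: image_closed.
- by move=> _ [_ [x Mx <-] <-]; exists (f x) => //; apply: fM; exists x.
Qed.

(** Zorn's lemma for unions is applied to the parts [U] removed from [K]; compactness keeps what
    remains nonempty along a chain. *)
Lemma minimal_exists f K : closed_invariant f K ->
  exists2 L, minimal_set f L & L `<=` K.
Proof.
move=> iK; pose P : set (set T) := [set U | closed_invariant f (K `\` U)].
have [|U [iU mU]] := @Zorn_bigcup _ P.
  move=> F FP totF.
  have [[U0 FU0]|F0] := pselect (F !=set0); last first.
    have -> : F = set0 by apply/seteqP; split=> // x Fx; apply: F0; exists x.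
    by rewrite bigcup_set0 /P /= setD0.
  have E x : (K `\` \bigcup_(U in F) U) x <-> forall U, F U -> (K `\` U) x.
    split=> [[Kx nx] U FU|H]; first by split=> // Ux; apply: nx; exists U.
    by split=> [|[U FU Ux]]; [have [] := H _ FU0|have [] := H _ FU].
  split.
  - pose G := filter_from F (fun U => K `\` U).
    have GF : ProperFilter G.
      apply: filter_from_proper => [|U /FP[]//].
      apply: filter_from_filter; first by exists U0.
      move=> U V FU FV; have [UV|VU] := totF _ _ FU FV.
      + exists V => // x [Kx Vx]; split; split=> //.
        by apply: contra_not Vx; exact: UV.
      + exists U => // x [Kx Ux]; split; split=> //.
        by apply: contra_not Ux; exact: VU.
    have [x [_ Gx]] := cT GF filterT; exists x; apply/E => U FU.
    have [_ + _] := FP _ FU; apply => B xB; apply: Gx => //.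
    by exists U.
  - move=> x clx; apply/E => U FU; have [_ + _] := FP _ FU; apply.
    by apply: closure_subset clx => y /E /(_ _ FU).
  - move=> _ [x /E Kx <-]; apply/E => U FU; have [_ _ +] := FP _ FU; apply.
    by exists x => //; exact: Kx.
exists (K `\` U) => //; split=> // N iN NM; apply/seteqP; split=> // x [Kx Ux].
apply: contrapT => Nx; apply: (mU (~` N)).
  split=> [y Uy Ny|UN]; first by have [] := NM _ Ny.
  by apply/Ux/UN.
rewrite /P /= setDE setCK; have -> // : K `&` N = N.
by apply/setIidPr => y /NM[].
Qed.

End minimal_sets.

(** * Minimal sets and branches at a fixed point *)

Lemma continuous_iter (T : topologicalType) (f : T -> T) n :
  continuous f -> continuous (iter n f).
Proof.
move=> cf; elim: n => [|n IH] x; first exact: cvg_id.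
exact: continuous_comp (IH x) (cf _).
Qed.

Lemma monotone_iter (T : topologicalType) (f : T -> T) n :
  monotone_map f -> monotone_map (iter n f).
Proof.
move=> mf C cC; elim: n => [//|n IH].
have -> : iter n.+1 f @^-1` C = f @^-1` (iter n f @^-1` C).
  by apply/seteqP; split=> x; rewrite /preimage /= -iterS iterSr.
exact: mf.
Qed.

Lemma fixed_iter (T : Type) (f : T -> T) n p : f p = p -> iter n f p = p.
Proof. by move=> fp; elim: n => //= n ->. Qed.

Section branch_dynamics.
Context {T : topologicalType}.
Hypotheses (hT : hausdorff_space T) (cT : compact [set: T]).
Hypothesis lcT : locally_connected T.
Implicit Types (f : T -> T) (a b p x y : T) (A B L M : set T).

Lemma btw_map f a b p : monotone_map f -> btw a b p -> btw (f a) (f b) (f p).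
Proof. by move=> mf ab C cC Ca Cb; apply: (ab (f @^-1` C)) => //; exact: mf. Qed.

Lemma nbtw_pull f a b p : monotone_map f -> f p = p ->
  ~ btw (f a) (f b) p -> ~ btw a b p.
Proof. by move=> mf fp nab ab; apply: nab; rewrite -fp; exact: btw_map. Qed.

Lemma nbtw_pull_iter n f a b p : monotone_map f -> f p = p ->
  ~ btw (iter n f a) (iter n f b) p -> ~ btw a b p.
Proof. by move=> mf fp; apply: nbtw_pull (fixed_iter _ fp); exact: monotone_iter. Qed.

(** Finitely many branches cover the compact [M], and points in distinct branches inject into
    them. *)
Lemma finitely_many_branches p M : closed M -> ~ M p ->
  exists N, forall s : seq T, uniq s -> (forall x, x \in s -> M x) ->
    {in s &, forall x y, x <> y -> btw x y p} -> (size s <= N)%N.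
Proof.
move=> cM Mp; have: compact M by exact: closed_compactT.
move=> /(@compact_seq_cover _ _ (branch p))[x Mx|D _ cov].
  by apply: branch_nbhs_self => // px; apply: Mp; rewrite px.
exists (size D) => s us sM sI.
have /choice[r rP] : forall x, exists i, M x -> i \in D /\ branch p i x.
  move=> x; have [Mx|nMx] := pselect (M x); last by exists x.
  by have [i iD ix] := cov x Mx; exists i => _.
rewrite -(size_map r); apply: uniq_leq_size.
  rewrite map_inj_in_uniq // => x y xs ys rxy; apply: contrapT => xy.
  have [[_ /nbtwC rx] [_ ry]] := (rP _ (sM _ xs), rP _ (sM _ ys)).
  by rewrite -rxy in ry; exact: (nbtw_trans rx ry (sI _ _ xs ys xy)).
by move=> _ /mapP[x xs ->]; have [] := rP _ (sM _ xs).
Qed.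

(* A maximal family of points of [M] in distinct branches is mapped to a family
   of points in distinct branches, by [nbtw_pull]; the image is thus maximal. *)
Lemma nbtw_push f p M a b : monotone_map f -> f p = p ->
  closed M -> f @` M `<=` M -> ~ M p -> M a -> M b ->
  ~ btw a b p -> ~ btw (f a) (f b) p.
Proof.
move=> mf fp cM fM Mp Ma Mb ab.
have neq x : M x -> p <> x by move=> Mx px; apply: Mp; rewrite px.
pose fam n := exists s : seq T, [/\ uniq s, (forall x, x \in s -> M x),
  {in s &, forall x y, x <> y -> btw x y p} & size s = n].
have [N HN] := finitely_many_branches cM Mp.
have [||n /asboolP[s [us sM sI sn]] mx] := @ex_maxnP (fun n => `[<fam n>]) N.
- by exists 0%N; apply/asboolP; exists [::]; split.
- by move=> i /asboolP[s [us sM sI <-]]; exact: HN.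
(* By maximality of [n], a family of [n] points meets the branch of every point of [M]. *)
have ext t c : uniq t -> (forall x, x \in t -> M x) ->
    {in t &, forall x y, x <> y -> btw x y p} -> size t = n -> M c ->
    exists2 d, d \in t & ~ btw d c p.
  move=> ut tM tI tn Mc; apply: contrapT => H.
  have {}H d : d \in t -> btw d c p.
    by move=> dt; apply: contrapT => dc; apply: H; exists d.
  have ct : c \notin t.
    by apply/negP => /H; rewrite btw_refl => /neq; apply.
  suff /mx : `[<fam n.+1>] by rewrite ltnn.
  apply/asboolP; exists (c :: t); split=> /=; rewrite ?ct ?tn //.
    by move=> x; rewrite inE => /orP[/eqP->//|/tM].
  move=> x y; rewrite !inE => /orP[/eqP->|xt] /orP[/eqP->|yt] xy //.
  - by rewrite btwC; exact: H.
  - exact: H.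
  - exact: tI.
have push x y : x \in s -> y \in s -> x <> y -> btw (f x) (f y) p.
  move=> xs ys xy; apply: contrapT => /(nbtw_pull mf fp); apply.
  exact: sI.
suff key c d : c \in s -> M d -> ~ btw c d p -> ~ btw (f c) (f d) p.
  have [c cs ca] := ext s a us sM sI sn Ma.
  have cb := nbtw_trans ca ab.
  by apply: (nbtw_trans (nbtwC (key _ _ cs Ma ca))); exact: key.
move=> cs Md cd.
have [||||| _ /mapP[c' cs' ->] c'd] := ext (map f s) (f d).
- rewrite map_inj_in_uniq // => x y xs ys fxy; apply: contrapT => xy.
  have := push _ _ xs ys xy; rewrite -fxy btw_refl => pfx; apply: Mp.
  by rewrite pfx; apply: fM; exists x => //; exact: sM.
- by move=> _ /mapP[x xs ->]; apply: fM; exists x => //; exact: sM.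
- move=> _ _ /mapP[x xs ->] /mapP[y ys ->] fxy; apply: push => // xy.
  by apply: fxy; rewrite xy.
- by rewrite size_map.
- by apply: fM; exists d.
(* Pulling back, [d] is in the branch of [c'] as well as in that of [c], and the family has one
   point in each branch. *)
suff -> : c = c' by [].
apply: contrapT => cc'.
exact: (nbtw_trans cd (nbtwC (nbtw_pull mf fp c'd)) (sI _ _ cs cs' cc')).
Qed.

Lemma nbtw_push_iter n f p M a b : monotone_map f -> f p = p ->
  closed M -> f @` M `<=` M -> ~ M p -> M a -> M b ->
  ~ btw a b p -> ~ btw (iter n f a) (iter n f b) p.
Proof.
move=> mf fp cM fM Mp Ma Mb ab; elim: n => //= n IH.
have iM := (@closed_invariant_iter _ f M n).
by apply: (nbtw_push mf fp cM fM Mp _ _ IH); apply: iM => //; split=> //; exists a.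
Qed.

(** If [x] and [f x] share a branch, [nbtw_push] keeps the orbit of [x] in it. By density all of [M]
    lies there, which [a] and [b] exclude. *)
Lemma fixed_point_moves_branches f p M a b x : continuous f -> monotone_map f ->
  minimal_set f M -> f p = p -> ~ M p -> M a -> M b -> btw a b p -> M x ->
  btw x (f x) p.
Proof.
move=> cf mf mM fp Mp Ma Mb ab Mx; apply: contrapT => xfx.
have [[_ cM fM] _] := mM.
have neq y : M y -> p <> y by move=> My py; apply: Mp; rewrite py.
have orb n : ~ btw x (iter n f x) p.
  elim: n => [|n IH]; first by apply: nbtw_refl; exact: neq.
  apply: nbtw_trans xfx _; rewrite iterS.
  by apply: (nbtw_push mf fp cM fM Mp) => //; exact: minimal_iter mM Mx.
have same c : M c -> ~ btw x c p.
  move=> Mc; have [||n nc] := @minimal_return _ _ _ (branch p c) x cf mM _ _ Mx.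
  - exact: branch_open.
  - by exists c; split=> //; exact: nbtw_refl (neq _ Mc).
  - exact: nbtw_trans (orb n) (nbtwC nc).
exact: (nbtw_trans (nbtwC (same _ Ma)) (same _ Mb)).
Qed.

Lemma branch_closedI p x M : closed M -> ~ M p -> closed (M `&` branch p x).
Proof.
move=> cM Mp y cly; have My : M y.
  by apply: cM; apply: closure_subset cly; exact: subIsetl.
split=> //.
have [//|yp] : (branch p x `|` [set p]) y.
  by apply: branch_closure => //; apply: closure_subset cly; exact: subIsetr.
by case: Mp; rewrite -yp.
Qed.

(** [k] is the first return time of [x0] to its branch. It serves every minimal set [B] entering
    this branch, because [nbtw_push] on the union of [A] and [B] makes points of one branch travel
    together. *)
Lemma branch_return f p A a b x0 : continuous f -> monotone_map f ->
  minimal_set f A -> f p = p -> ~ A p -> A a -> A b -> btw a b p -> A x0 ->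
  exists2 k, ~ btw x0 (iter k f x0) p &
  [/\ (0 < k)%N, (forall n y, ~ btw x0 (iter n f y) p ->
        exists2 r, (r < k)%N & ~ btw x0 (iter r f y) p) &
    forall B, minimal_set f B -> ~ B p -> B `&` branch p x0 !=set0 ->
    minimal_set (iter k f) (B `&` branch p x0) /\
    exists2 v, B v & ~ branch p x0 v].
Proof.
move=> cf mf mA fp Ap Aa Ab ab Ax0.
have neqA y : A y -> p <> y by move=> Ay py; apply: Ap; rewrite py.
have [[_ cA fA] _] := mA.
have Aiter n : A (iter n f x0) by exact: minimal_iter mA Ax0.
pose ret k := `[<(0 < k)%N /\ ~ btw x0 (iter k f x0) p>].
have ex_ret : exists k, ret k.
  have [||n nx0] := @minimal_return _ _ _ (branch p x0) (f x0) cf mA _ _ (Aiter 1%N).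
  - exact: branch_open.
  - by exists x0; split=> //; exact: nbtw_refl (neqA _ Ax0).
  - by exists n.+1; apply/asboolP; split=> //; rewrite iterSr.
have [k /asboolP[k0 xkx] kmin] := ex_minnP ex_ret.
have loop q : ~ btw x0 (iter (q * k) f x0) p.
  elim: q => [|q IH]; first by apply: nbtw_refl; exact: neqA.
  rewrite mulSn iterD; apply: nbtw_trans xkx _.
  exact: (nbtw_push_iter mf fp cA fA Ap).
(* Points are pulled back along the largest multiple of [k] below [n], after which [x0] is back in
   its branch. *)
have red n y : ~ btw x0 (iter n f y) p -> ~ btw x0 (iter (n %% k) f y) p.
  rewrite {1}(divn_eq n k) iterD => ny.
  apply: (@nbtw_pull_iter (n %/ k * k) f) => //.
  exact: nbtw_trans (nbtwC (loop _)) ny.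
have dvd n : ~ btw x0 (iter n f x0) p -> (k %| n)%N.
  move=> /red nx; rewrite /dvdn -leqn0 leqNgt; apply/negP => r0.
  have := kmin (n %% k)%N; rewrite leqNgt ltn_mod k0 => /(_ _)/negP; apply=> //.
  by apply/asboolP.
exists k => //; split=> [//|n y ny|B mB Bp [y [By x0y]]].
  by exists (n %% k)%N; [rewrite ltn_mod|exact: red].
have [[_ cB fB] _] := mB.
have neqB z : B z -> p <> z by move=> Bz pz; apply: Bp; rewrite pz.
have Biter n z : B z -> B (iter n f z) by exact: minimal_iter mB.
have cAB : closed (A `|` B) by exact: closedU.
have fAB : f @` (A `|` B) `<=` A `|` B.
  by move=> _ [z [Az|Bz] <-]; [left; apply: fA|right; apply: fB]; exists z.
have ABp : ~ (A `|` B) p by case.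
have push n z : B z -> ~ btw x0 z p -> ~ btw (iter n f x0) (iter n f z) p.
  by move=> Bz; apply: (nbtw_push_iter mf fp cAB fAB ABp); [left|right].
split; last first.
  exists (f y); first exact: (Biter 1%N).
  move=> x0fy.
  have := nbtw_trans x0fy (nbtwC (push 1%N _ By x0y)); apply.
  exact: (fixed_point_moves_branches cf mf mA fp Ap Aa Ab ab).
apply: minimal_intro.
  split; [by exists y|exact: branch_closedI|].
  move=> _ [z [Bz x0z] <-]; split; first exact: Biter.
  exact: nbtw_trans xkx (push k _ Bz x0z).
move=> z U [Bz x0z] oU [w [[Bw x0w] Uw]].
have [||n [Un nz]] := @minimal_return _ _ _ (U `&` branch p x0) z cf mB _ _ Bz.
- by apply: openI => //; exact: branch_open.
- by exists w.
(* Return times to the branch are multiples of [k], so this visit of [U] is made by the iterates of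
   [iter k f]. *)
have /dvd/dvdnP[q nq] : ~ btw x0 (iter n f x0) p.
  exact: nbtw_trans nz (nbtwC (push n _ Bz x0z)).
by exists q; rewrite -iterM -nq.
Qed.

End branch_dynamics.

(** * Limits of minimal sets *)

Section hits.
Context {T : topologicalType} {I : Type}.
Hypotheses (hT : hausdorff_space T) (cT : compact [set: T]).
Context (F : set_system I) {FU : UltraFilter F}.
Implicit Types (S : I -> set T) (N : set T).

(* For an ultrafilter this is also the upper limit, see [lower_limit_hit]. *)
Definition lower_limit S : set T :=
  [set x | forall U, nbhs x U -> F [set i | S i `&` U !=set0]].

Lemma lower_limit_closed S : closed (lower_limit S).
Proof.
move=> x clx U; rewrite nbhsE => -[V [oV Vx] VU].
have [y [Ly Vy]] := clx V (open_nbhs_nbhs (conj oV Vx)).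
apply: filterS (Ly V (open_nbhs_nbhs (conj oV Vy))) => i [z [Sz Vz]].
by exists z; split=> //; exact: VU.
Qed.

(** The sets containing the trace of [S i] on [N] for [F]-many [i] form a proper filter. It has a
    cluster point in [N], no neighbourhood of which is missed by [F]-many traces; the ultrafilter
    then makes [F]-many [S i] meet it. *)
Lemma lower_limit_hit S N : closed N -> F [set i | S i `&` N !=set0] ->
  N `&` lower_limit S !=set0.
Proof.
move=> cN FN.
pose G : set_system T := [set Q | F [set i | S i `&` N `<=` Q]].
have GF : ProperFilter G.
  apply: Build_ProperFilter.
    by move=> G0; have [i [[x SNx] H]] := filter_ex (filterI FN G0); exact: H SNx.
  constructor.
  - by apply: (@filterS _ F) filterT => i _ x _.
  - move=> P Q GP GQ; apply: (@filterS _ F) (@filterI _ F _ _ _ GP GQ) => i [iP iQ] x ix.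
    by split; [exact: iP|exact: iQ].
  - by move=> P Q PQ; apply: (@filterS _ F) => i iP x /iP/PQ.
have GN : G N by apply: (@filterS _ F) filterT => i _ x [].
have [x [Nx Gx]] := closed_compactT cT cN GF GN.
exists x; split=> // U xU.
have [//|nU] := in_ultra_setVsetC [set i | S i `&` U !=set0] FU.
have [|y [] //] := Gx (~` U) U _ xU.
by apply: filterS nU => i iU y [Sy _] Uy; apply: iU; exists y.
Qed.

(** A closed neighbourhood of [y] off the image would have a preimage hit by [F]-many [S i], hence
    by the lower limit. *)
Lemma lower_limit_image S f : continuous f -> F [set i | S i `<=` f @` (S i)] ->
  lower_limit S `<=` f @` lower_limit S.
Proof.
move=> cf FS y Ly; apply: contrapT => nfy.
have cfL : closed (f @` lower_limit S).
  by apply: image_closed => //; exact: lower_limit_closed.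
have yfL : nbhs y (~` (f @` lower_limit S)).
  by apply: open_nbhs_nbhs; split=> //; exact: closed_openC.
have [V yV VL] := compact_regular hT cT filterT yfL.
have [||w [/= Vfw Lw]] := @lower_limit_hit S (f @^-1` closure V).
- by apply: preimage_closed => //; exact: closed_closure.
- apply: filterS (filterI FS (Ly V yV)) => i [/= fS [z [Sz Vz]]].
  have [w Sw fw] := fS _ Sz; exists w; split=> //=.
  by rewrite fw; exact: subset_closure.
by apply: (VL (f w)) => //; exists w.
Qed.

Lemma lower_limit_invariant S f : continuous f ->
  F [set i | f @` (S i) `<=` S i] -> f @` lower_limit S `<=` lower_limit S.
Proof.
move=> cf FS _ [x Lx <-] U /cf/Lx FU'.
apply: filterS (filterI FS FU') => i [fS [z [Sz Uz]]].
by exists (f z); split=> //; apply: fS; exists z.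
Qed.

End hits.

(** * Fixed points separating minimal sets *)

Section dendrite_dynamics.
Context {T : topologicalType}.
Hypotheses (hT : hausdorff_space T) (cT : compact [set: T]).
Hypothesis lcT : locally_connected T.
Hypothesis connT : connected [set: T].
Hypothesis btw_acc : forall z u (W : set T), z <> u -> nbhs z W ->
  exists2 w, W w & w <> z /\ btw z u w.
Hypothesis btw_near : forall a b z : T, ~ btw a b z ->
  exists A B Z, [/\ nbhs a A, nbhs b B, nbhs z Z &
    forall a' b' z', A a' -> B b' -> Z z' -> ~ btw a' b' z'].
Implicit Types (f : T -> T) (a b p x y : T) (A B L M : set T).

(* The point [z] is maximal, in the order of separation from [a], among the
   points of the hull of [M] separating [a] from their image. *)
Lemma separating_fixed_point f M : continuous f -> monotone_map f ->
  minimal_set f M -> (forall p, M <> [set p]) ->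
  exists p, [/\ f p = p, ~ M p & exists a b, [/\ M a, M b & btw a b p]].
Proof.
move=> cf mf mM Mns; have [[[a Ma] cM fM] _] := mM.
pose G := [set z | btw a (f z) z /\ exists2 b, M b & btw a b z].
have Ga : G a by split; [exact: btwl|exists a => //; exact: btwl].
pose R (z w : {z | G z}) : bool := `[< btw a (sval w) (sval z) >].
have [|||zz mz] := @ZL_preorder _ (exist _ a Ga : {z | G z}) R.
- by move=> z; apply/asboolP; exact: btwr.
- move=> r s t /asboolP rs /asboolP st; apply/asboolP => C cC Ca Ct.
  by apply: rs => //; exact: st.
- move=> A totA.
  (* A chain is bounded by a cluster point [s] of its tails: branches are open, so [s] is beyond
     each member, and [btw_near] passes the conditions defining [G] to the limit. *)
  have [[z0 Az0]|A0] := pselect (A !=set0); last first.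
    by exists (exist _ a Ga) => z Az; case: A0; exists z.
  pose tail z : set T := [set sval w | w in [set w | A w /\ R z w]].
  pose F := filter_from A tail.
  have FF : ProperFilter F.
    apply: filter_from_proper => [|z Az]; last first.
      by exists (sval z); exists z => //; split=> //; apply/asboolP; exact: btwr.
    apply: filter_from_filter; first by exists z0.
    move=> z w Az Aw.
    have trans u v : R u v -> tail v `<=` tail u.
      move=> /asboolP uv _ [t [At /asboolP vt] <-]; exists t => //; split=> //.
      by apply/asboolP => C cC Ca Ct; apply: uv => //; exact: vt.
    have [zw|wz] := totA _ _ Az Aw.
    + by exists w => // t wt; split=> //; exact: trans wt.
    + by exists z => // t zt; split=> //; exact: trans zt.
  have [s [_ Fs]] := cT FF filterT.
  have As z : A z -> btw a s (sval z).
    move=> Az; apply: contrapT => nz.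
    have [_ [[w [_ zw] <-] bw]] : tail z `&` branch (sval z) a !=set0.
      by apply: Fs; [exists z|exact: branch_nbhs].
    by move/asboolP: zw; exact: bw.
  have AF : F [set sval w | w in A].
    by exists z0 => // _ [w [Aw _] <-]; exists w.
  suff Gs : G s by exists (exist _ s Gs) => z Az; apply/asboolP; exact: As.
  split.
    apply: contrapT => /btw_near[A' [B [Z [aA fsB sZ]]]] H.
    have [_ [[w Aw <-] [/= Bfw Zw]]] :
        [set sval w | w in A] `&` ((f @^-1` B) `&` Z) !=set0.
      by apply: Fs => //; apply: filterI => //; exact: cf.
    have [wfw _] := svalP w.
    by apply: (H a (f (sval w)) (sval w)) => //; exact: nbhs_singleton.
  apply: contrapT => nS.
  have cptM : compact M by exact: closed_compactT.
  have sM : \forall z \near s, M `<=` (fun b => ~ btw a b z).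
    move/compact_near_coveringP : cptM => /(_ _ (nbhs s) (fun z b => ~ btw a b z)).
    apply=> x Mx; have /btw_near[A' [B [Z [aA xB sZ]]]] : ~ btw a x s.
      by move=> axs; apply: nS; exists x.
    move=> H; exists (B, Z) => //= -[b z] [/= Bb Zz].
    by apply: H => //; exact: nbhs_singleton.
  have [_ [[w Aw <-]]] := Fs _ _ AF sM.
  by have [_ [b Mb abw]] := svalP w; move=> /(_ _ Mb).
have := svalP zz; set z := sval zz => -[zfz [b Mb abz]].
exists z; suff fz : f z = z.
  split=> //; last by exists a, b.
  by move=> Mz; apply: (Mns z); exact: minimal_fixed mM fz Mz.
apply: contrapT => fzz; set u := f z in fzz zfz.
have zu : z <> u by move=> zu; apply: fzz.
(* If [f] moves [z], take [c] strictly between [z] and [f z], then [w] between [z] and [c] so close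
   to [z] that [f w] is still beyond [c]. This [w] is in [G] and contradicts the maximality of
   [z]. *)
have [c cu [cz zuc]] := btw_acc zu (nbhs_neq hT zu).
have [w cufw [wz zcw]] : exists2 w, (f @^-1` branch c u) w & w <> z /\ btw z c w.
  apply: btw_acc; first by move=> zc; apply: cz.
  by apply: cf; apply: branch_nbhs_self.
have h1 : ~ btw c u z.
  rewrite btwC => ucz; apply: cz; rewrite btwC in zuc.
  exact/esym/(btw_antisym hT lcT connT ucz zuc).
have h2 : btw a c z.
  by apply: contrapT => /nbtw_trans/(_ h1).
have h4 : btw a (f w) c.
  apply: contrapT => /nbtw_trans/(_ (nbtwC cufw)); apply=> C cC Ca Cu.
  by apply: zuc => //; exact: zfz.
have h7 : ~ btw w c z.
  rewrite btwC => cwz; apply: wz; rewrite btwC in zcw.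
  exact: (btw_antisym hT lcT connT zcw cwz).
have h8 : btw a w z by apply: contrapT => /nbtw_trans/(_ h7).
have Gw : G w.
  split.
    move=> C cC Ca Cfw; have Cc : C c by exact: h4.
    by apply: zcw => //; exact: h2.
  (* The point [u] separates [f a] from [f b], so it separates [a] from one of them. *)
  have [b' Mb' ab'u] : exists2 b', M b' & btw a b' u.
    apply: contrapT => H.
    have H' x : M x -> ~ btw a x u by move=> Mx axu; apply: H; exists x.
    have fMx x : M x -> M (f x) by move=> Mx; apply: fM; exists x.
    apply: (nbtw_trans (nbtwC (H' _ (fMx _ Ma))) (H' _ (fMx _ Mb))).
    exact: btw_map.
  exists b' => // C cC Ca Cb'; have Cu : C u by exact: ab'u.
  have Cz : C z by exact: zfz.
  have Cc : C c by exact: zuc.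
  exact: zcw.
have zRw : R zz (exist _ w Gw) by exact/asboolP.
have /asboolP /= wa := mz _ zRw.
apply: wz; exact: (btw_antisym hT lcT connT wa h8).
Qed.

(** In other words, [(p, y)] is in the closure of the union of the squares of the minimal sets. *)
Definition minimal_near f p y := forall U V, nbhs p U -> nbhs y V ->
  exists M, [/\ minimal_set f M, M `&` U !=set0 & M `&` V !=set0].

(** A minimal set coming close to [p] and [z] is separated by [c], so [f] moves each of its points
    to another branch at [c]. But for [x] near [p], both [x] and [f x] are in the branch of [p]. *)
Lemma minimal_near_fixed f p z c : continuous f -> monotone_map f -> f p = p ->
  f c = c -> minimal_near f p z -> btw p z c -> c <> p -> c <> z -> False.
Proof.
move=> cf mf fp fc Mpz pzc cp cz.
have pU : nbhs p (branch c p `&` f @^-1` branch c p).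
  by apply: filterI; [|apply: cf; rewrite fp]; exact: branch_nbhs_self.
have [M [mM [x [Mx [px pfx]]] [z' [Mz' zz']]]] :=
  Mpz _ _ pU (branch_nbhs_self hT lcT cz).
have Mc : ~ M c.
  by move=> Mc; apply: px; move: Mx; rewrite (minimal_fixed hT mM fc Mc) => ->; exact: btwr.
have xz' : btw x z' c.
  apply: contrapT => nxz'.
  exact: (nbtw_trans (nbtw_trans px nxz') (nbtwC zz')).
have := fixed_point_moves_branches hT cT lcT cf mf mM fc Mc Mx Mz' xz' Mx.
exact: (nbtw_trans (nbtwC px) pfx).
Qed.

(* [q] is close to [p], because it separates a point close to [p] from its
   image, and if [q <> p] then [q] separates [p] from [y] or [f y]. *)
Lemma separating_fixed_point_near f p y : continuous f -> monotone_map f ->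
  f p = p -> y <> p -> f y <> p -> minimal_near f p y ->
  exists U V, [/\ nbhs p U, nbhs y V & forall M a b q, minimal_set f M ->
    M `&` U !=set0 -> M `&` V !=set0 -> f q = q -> ~ M q ->
    M a -> M b -> btw a b q -> q = p].
Proof.
move=> cf mf fp yp fyp Mpy.
have Mpfy : minimal_near f p (f y).
  move=> U V pU fyV; have [M [mM MU [z [Mz Vz]]]] := Mpy _ _ pU (cf _ _ fyV).
  exists M; split=> //; exists (f z); split=> //.
  exact: (minimal_iter 1 mM Mz).
have [U1 [V1 [[oU1 cU1] [oV1 cV1] UV1]]] := connected_disjoint_nbhs hT lcT (nesym yp).
have [U2 [V2 [[oU2 cU2] [oV2 cV2] UV2]]] := connected_disjoint_nbhs hT lcT (nesym fyp).
have [W [oW Wp cW WU]] : exists W : set T,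
    [/\ open W, W p, connected W & W `<=` U1 `&` U2].
  by apply: lcT; apply: filterI; exact: open_nbhs_nbhs.
have pW : nbhs p W by exact: open_nbhs_nbhs.
exists (W `&` f @^-1` W), (V1 `&` f @^-1` V2); split.
- by apply: filterI => //; apply: cf; rewrite fp.
- by apply: filterI; [|apply: cf]; exact: open_nbhs_nbhs.
move=> M a b q mM [x [Mx [Wx Wfx]]] [y' [My' [Vy' Vfy']]] fq Mq Ma Mb ab.
have mv := fixed_point_moves_branches hT cT lcT cf mf mM fq Mq Ma Mb ab.
have Wq : W q by apply: (mv x Mx).
have [U1q U2q] := WU _ Wq.
have V1q : ~ V1 q by move=> V1q; have : set0 q by rewrite -UV1.
have V2q : ~ V2 q by move=> V2q; have : set0 q by rewrite -UV2.
apply: contrapT => qp.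
have yy' : ~ btw y y' q by apply/btwPn; exists V1; case: oV1.
have fyfy' : ~ btw (f y') (f y) q by apply/btwPn; exists V2; case: oV2.
have [pyq|pyq] := pselect (btw p y q).
  apply: (minimal_near_fixed cf mf fp fq Mpy) => //.
  exact: nbtw_neql yy'.
have [pfyq|pfyq] := pselect (btw p (f y) q).
  apply: (minimal_near_fixed cf mf fp fq Mpfy) => //.
  exact: nbtw_neqr fyfy'.
(* Now [y'] and [f y'] are both in the branch of [p] at [q], although [q] separates them. *)
apply: (nbtw_trans _ _ (mv y' My')); first exact: (nbtw_trans (nbtwC yy') (nbtwC pyq)).
exact: (nbtw_trans pfyq (nbtwC fyfy')).
Qed.

Lemma nbhs_iter f p U k : continuous f -> f p = p -> nbhs p U ->
  nbhs p [set x | forall r, (r < k)%N -> U (iter r f x)].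
Proof.
move=> cf fp pU; elim: k => [|k IH]; first exact: filterS filterT.
have := @continuous_iter _ f k cf p U; rewrite (fixed_iter _ fp) => /(_ pU) Uk.
apply: filterS (filterI IH Uk) => x [xk Ux] r.
by rewrite ltnS leq_eqVlt => /orP[/eqP ->|/xk].
Qed.

Section limits_of_minimal_sets.
Context {I : Type} (F : set_system I) {FU : UltraFilter F}.
Context (f : T -> T) (cf : continuous f) (mf : monotone_map f).
Context (S : I -> set T) (mS : F [set i | minimal_set f (S i)]).

Lemma lower_limit_iter k y : lower_limit F S y ->
  exists2 w, lower_limit F S w & iter k f w = y.
Proof.
have sub : F [set i | S i `<=` f @` (S i)].
  by apply: filterS mS => i mSi; rewrite /= (minimal_image hT cT cf mSi).
elim: k y => [|k IH] y Ly; first by exists y.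
have [z Lz zy] := lower_limit_image hT cT cf sub Ly.
by have [w Lw wz] := IH _ Lz; exists w => //; rewrite iterS wz.
Qed.

(* Otherwise some limit point [z] has [f z <> p], and [p] separates the sets
   [S i].  The pieces of the [S i] in the component of [z] are minimal for an
   iterate of [f] and come close to both [p] and a preimage of [z] in that
   component; so [p] should separate them too, which is absurd. *)
Lemma lower_limit_fixed p y : lower_limit F S p -> f p = p ->
  lower_limit F S y -> y = p.
Proof.
move=> Lp fp Ly0; apply: contrapT => y0p.
have [z Lz /= fz] := lower_limit_iter 1 Ly0.
have {y0p} fzp : f z <> p by rewrite fz.
have zp : z <> p by move=> zp; apply: fzp; rewrite zp.
have Mpz : minimal_near f p z.
  move=> U V pU zV; have [i [mSi [SU SV]]] :=
    filter_ex (filterI mS (filterI (Lp U pU) (Lz V zV))).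
  by exists (S i).
have [U [V [pU zV UV]]] := separating_fixed_point_near cf mf fp zp fzp Mpz.
have [U' [V' [[oU' _] [oV' _] UV']]] := connected_disjoint_nbhs hT lcT (nesym zp).
pose good := [set i | [/\ minimal_set f (S i), ~ S i p,
  S i `&` branch p z !=set0 & exists a b, [/\ S i a, S i b & btw a b p]]].
have Fgood : F good.
  have pUU' : nbhs p (U `&` U') by apply: filterI => //; exact: open_nbhs_nbhs.
  have zVV' : nbhs z ((V `&` V') `&` branch p z).
    apply: filterI; first by apply: filterI => //; exact: open_nbhs_nbhs.
    exact: branch_nbhs_self (nesym zp).
  apply: filterS (filterI mS (filterI (Lp _ pUU') (Lz _ zVV'))).
  move=> i [mSi [[u [Su [Uu U'u]]] [v [Sv [[Vv V'v] zv]]]]].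
  have [|q [fq Sq [a [b [Sa Sb ab]]]]] :=
      separating_fixed_point cf mf mSi.
    move=> q Sq; have vu : v = u by move: Su Sv; rewrite Sq => -> ->.
    have : set0 u by rewrite -UV'; split=> //; rewrite -vu.
    by [].
  have qp : q = p.
    by apply: (UV (S i) a b) => //; [exists u|exists v].
  rewrite qp in Sq ab; split=> //; first by exists v.
  by exists a, b.
have [i0 [mA Ap [x0 [Ax0 zx0]] [a [b [Aa Ab ab]]]]] := filter_ex Fgood.
have [k xkx [k0 red HB]] := branch_return hT cT lcT cf mf mA fp Ap Aa Ab ab Ax0.
have Ez := branchE zx0; rewrite /good Ez in Fgood.
have [w Lw gw] := lower_limit_iter k Lz.
have gp : iter k f p = p by exact: fixed_iter.
have wp : w <> p by move=> wp; apply: zp; rewrite -gw wp.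
have gwp : iter k f w <> p by rewrite gw.
have x0w : branch p x0 w.
  apply: (@nbtw_pull_iter _ k f) => //; rewrite gw.
  exact: nbtw_trans (nbtwC xkx) (nbtwC zx0).
have near U1 V1 : nbhs p U1 -> nbhs w V1 -> exists M,
    [/\ minimal_set (iter k f) M, M `<=` branch p x0, M `&` U1 !=set0 &
        M `&` V1 !=set0].
  move=> pU1 wV1.
  have wV2 : nbhs w (V1 `&` branch p x0) by apply: filterI => //; exact: branch_nbhs.
  have [i [[mSi Sp Sx0 _] [[u [Su Uu]] [v [Sv [Vv x0v]]]]]] := filter_ex
    (filterI Fgood (filterI (Lp _ (nbhs_iter k cf fp pU1)) (Lw _ wV2))).
  have [mSx0 _] := HB _ mSi Sp Sx0.
  exists (S i `&` branch p x0); split=> //; last by exists v.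
  (* The first [k] iterates of [u], starting with [u] itself, are in [U1]. By minimality some
     iterate enters the branch, and [red] brings its exponent below [k]. *)
  have [n x0n] := minimal_return cf mSi (branch_open hT lcT p x0) Sx0 Su.
  have [r rk x0r] := red _ _ x0n.
  exists (iter r f u); split; last exact: Uu.
  by split=> //; exact: minimal_iter mSi Su.
have cg := @continuous_iter _ f k cf; have mg := @monotone_iter _ f k mf.
have Mpw : minimal_near (iter k f) p w.
  by move=> U1 V1 pU1 wV1; have [M [mM _ MU MV]] := near _ _ pU1 wV1; exists M.
have [U1 [V1 [pU1 wV1 UV1]]] := separating_fixed_point_near cg mg gp wp gwp Mpw.
have [U2 [V2 [[oU2 _] [oV2 _] UV2]]] := connected_disjoint_nbhs hT lcT (nesym wp).
have [||M [mM Mx0 [u [Mu [U1u U2u]]] [v [Mv [V1v V2v]]]]] := near (U1 `&` U2) (V1 `&` V2).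
- by apply: filterI => //; exact: open_nbhs_nbhs.
- by apply: filterI => //; exact: open_nbhs_nbhs.
have [|q [gq Mq [c [d [Mc Md cd]]]]] :=
    separating_fixed_point cg mg mM.
  move=> q Mq; have vu : v = u by move: Mu Mv; rewrite Mq => -> ->.
  have : set0 u by rewrite -UV2; split=> //; rewrite -vu.
  by [].
have qp : q = p by apply: (UV1 M c d) => //; [exists u|exists v].
rewrite qp in cd; exact: nbtw_trans (nbtwC (Mx0 _ Mc)) (Mx0 _ Md) cd.
Qed.

End limits_of_minimal_sets.

(** * Nested pieces cut at separating fixed points *)

Section tower.
Context (y : T) (D : nat -> set T) (p : nat -> T).
Hypothesis DS : forall j, D j.+1 = D j `&` branch (p j) y.

Lemma tower_sub i j : (i <= j)%N -> D j `<=` D i.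
Proof.
elim: j => [|j IH]; first by rewrite leqn0 => /eqP->.
rewrite leq_eqVlt => /orP[/eqP->//|/IH sij].
by apply: subset_trans sij; rewrite DS; exact: subIsetl.
Qed.

(* [p j] separates a point [v j] of [B] at level [j] from every point of the
   intersection of all levels, among which are the cluster points of [v]. *)
Lemma tower_limit B N0 : (forall j, (N0 <= j)%N -> closed (B `&` D j)) ->
  (forall j, (N0 <= j)%N -> exists2 v, (B `&` D j) v & ~ branch (p j) y v) ->
  forall W, open W -> B `<=` W ->
  exists N, forall j, (N <= j)%N -> W (p j).
Proof.
move=> cB Bv W oW BW; apply: contrapT => H.
pose Q N := [set v | exists j, [/\ (N <= j)%N, (N0 <= j)%N, ~ W (p j),
  (B `&` D j) v & ~ branch (p j) y v]].
have FF : ProperFilter (filter_from setT Q).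
  apply: filter_from_proper => [|N _].
    apply: filter_fromT_filter; first by exists 0%N.
    move=> i j; exists (maxn i j) => v [k [+ N0k Wk Bk nk]].
    by rewrite geq_max => /andP[ik jk]; split; exists k.
  apply: contrapT => nQ; apply: H; exists (maxn N N0) => j.
  rewrite geq_max => /andP[Nj N0j]; apply: contrapT => Wj; apply: nQ.
  by have [v Bjv nv] := Bv _ N0j; exists v, j.
have [v [_ Fv]] := cT FF filterT.
have BDv i : (N0 <= i)%N -> (B `&` D i) v.
  move=> N0i; apply: cB => // U vU.
  have [u [[j [ij _ _ [Bu Dju] _]] Uu]] : Q i `&` U !=set0.
    by apply: Fv => //; exists i.
  by exists u; split=> //; split=> //; exact: tower_sub Dju.
have [U [oU Uv cU UW]] : exists U : set T, [/\ open U, U v, connected U & U `<=` W].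
  by apply: lcT; apply: open_nbhs_nbhs; split=> //; apply: BW; have [] := BDv N0 _.
have [u [[j [_ N0j nWj Bju nu]] Uu]] : Q N0 `&` U !=set0.
  by apply: Fv; [exists N0|exact: open_nbhs_nbhs].
apply: nu; apply: (@nbtw_trans _ v).
  by have [_] := BDv j.+1 (leqW N0j); rewrite DS => -[].
by apply/btwPn; exists U => //; split=> // /UW.
Qed.

End tower.

Section limits_of_minimal_sets.
Context {I : Type} (F : set_system I) {FU : UltraFilter F}.
Context (f : T -> T) (cf : continuous f) (mf : monotone_map f).
Context (S : I -> set T) (mS : F [set i | minimal_set f (S i)]).
Context (L : set T) (y : T).
Hypotheses (mL : minimal_set f L) (LS : L `<=` lower_limit F S).
Hypotheses (Sy : lower_limit F S y) (Ly : ~ L y).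

Definition tower_level (s : nat * set T) :=
  [/\ open s.2, s.2 y, minimal_set (iter s.1 f) (L `&` s.2) &
      F [set i | minimal_set (iter s.1 f) (S i `&` s.2)]].

(* A state [(m, D)] records that [L `&` D] is minimal for [iter m f]; [p] is the
   separating fixed point at which [D] is cut. *)
Definition tower_step (s : nat * set T) (p : T) (s' : nat * set T) :=
  [/\ iter s.1 f p = p, ~ (L `&` s.2) p, s'.2 = s.2 `&` branch p y &
  forall B, minimal_set (iter s.1 f) (B `&` s.2) -> ~ (B `&` s.2) p ->
    B `&` s'.2 !=set0 -> minimal_set (iter s'.1 f) (B `&` s'.2) /\
    exists2 v, (B `&` s.2) v & ~ branch p y v].

(** If [L] had a single point in [D], this fixed limit point would be [y] by [lower_limit_fixed]; so
    some fixed point [p] separates the piece of [L]. By the same lemma [p] is no limit point, hence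
    [F]-many [S i] avoid it in [D]. The cut keeps the side of [y]. *)
Lemma tower_next s : tower_level s ->
  exists p s', tower_step s p s' /\ tower_level s'.
Proof.
case: s => m D [/= oD Dy mLD mSD].
pose g := iter m f.
have cg : continuous g by exact: continuous_iter.
have mg : monotone_map g by exact: monotone_iter.
have sub x : lower_limit F S x -> D x -> lower_limit F (fun i => S i `&` D) x.
  move=> Sx Dx U xU; have xUD : nbhs x (U `&` D).
    by apply: filterI => //; exact: open_nbhs_nbhs.
  by apply: filterS (Sx _ xUD) => i [u [Su [Uu Du]]]; exists u.
have SDy := sub _ Sy Dy.
have [|p [gp LDp [a [b [LDa LDb ab]]]]] :=
    separating_fixed_point cg mg mLD.
  move=> x LDx; have [Lx Dx] : (L `&` D) x by rewrite LDx.
  have gx : g x = x.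
    by have := minimal_iter 1 mLD (conj Lx Dx); rewrite LDx.
  have yx := lower_limit_fixed cg mg mSD
    (sub _ (LS Lx) Dx) gx SDy.
  by apply: Ly; rewrite yx.
have [[La Da] [Lb Db]] := (LDa, LDb).
have nSDp : ~ lower_limit F (fun i => S i `&` D) p.
  move=> SDp; apply: LDp.
  by rewrite -(lower_limit_fixed cg mg mSD
    SDp gp (sub _ (LS La) Da)).
have Sp : F [set i | ~ (S i `&` D) p].
  move: nSDp => /existsNP[U /not_implyP[pU nU]].
  have [//|{}nU] := in_ultra_setVsetC [set i | (S i `&` D) `&` U !=set0] FU.
  apply: filterS nU => i nU SDp; apply: nU.
  by exists p; split=> //; exact: nbhs_singleton.
have py : p <> y by move=> py; apply: nSDp; rewrite py.
have Sby := SDy _ (branch_nbhs_self hT lcT py).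
have pa : p <> a by move=> pa; apply: LDp; rewrite pa.
(* Some [S i] comes close to both [y] and [a]. An iterate takes its point near [a] to the branch of
   [y], and [nbtw_push_iter] makes [a] follow. *)
have [x0 [LDx0 yx0]] : L `&` D `&` branch p y !=set0.
  have [i [mSDi [nSDi [[y' SDy'] [x' [SDx' ax']]]]]] := filter_ex (filterI mSD
    (filterI Sp (filterI Sby (sub _ (LS La) Da _ (branch_nbhs_self hT lcT pa))))).
  have [|n yx'] := minimal_return cg mSDi (branch_open hT lcT p y) _ SDx'.
    by exists y'.
  have [[_ cL gL] _] := mLD; have [[_ cSi gS] _] := mSDi.
  exists (iter n g a); split; first exact: minimal_iter mLD _.
  apply: nbtw_trans yx' (nbtwC _).
  apply: (@nbtw_push_iter _ hT cT lcT n g p ((L `&` D) `|` (S i `&` D))) => //.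
  - exact: closedU.
  - by move=> _ [z [LDz|SDz] <-]; [left; apply: gL|right; apply: gS]; exists z.
  - by case.
  - by left.
  - by right.
have [k xkx [_ _ HB]] :=
  branch_return hT cT lcT cg mg mLD gp LDp LDa LDb ab LDx0.
rewrite -(branchE yx0) in HB.
have gk : iter k g = iter (k * m) f by apply/funext => x; rewrite iterM.
exists p, ((k * m)%N, D `&` branch p y); split.
  split=> //= B mB Bp; rewrite setIA => B0.
  by rewrite -gk; exact: HB.
split=> /=.
- by apply: openI => //; exact: branch_open.
- by split=> //; exact: nbtw_refl.
- by rewrite setIA -gk; have [] := HB _ mLD LDp (ex_intro _ _ (conj LDx0 yx0)).
- apply: filterS (filterI mSD (filterI Sp Sby)) => i [mSDi [nSDi Siy]] /=.
  by rewrite setIA -gk; have [] := HB _ mSDi nSDi Siy.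
Qed.

Lemma lower_limit_not_outside : False.
Proof.
pose St := {s | tower_level s}.
have lev0 : tower_level (1%N, setT).
  by split=> //=; [exact: openT|rewrite setIT|under eq_set do rewrite setIT].
have [|st [st0 stS]] := @dependent_choice St
    (fun s s' => exists p, tower_step (sval s) p (sval s')) _ (exist _ _ lev0).
  move=> [s ls]; apply: cid; have [p [s' [ss' ls']]] := tower_next ls.
  by exists (exist _ s' ls'), p.
have {stS}/choice[p step] := stS.
pose m j := (sval (st j)).1; pose D j := (sval (st j)).2.
have lev j : tower_level (sval (st j)) by exact: svalP.
have DS j : D j.+1 = D j `&` branch (p j) y by have [] := step j.
have oL : open (~` L) by apply/closed_openC/(minimal_closed mL).
(* The points [p j] approach [L] by [tower_limit], so they eventually avoid the connected
   neighbourhood [V] of [y], whose closure misses [L]. *)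
have [W yW WL] := compact_regular hT cT filterT (open_nbhs_nbhs (conj oL Ly)).
have [V [oV Vy cV VW]] := lcT yW.
have Llim := @tower_limit y D p DS L 0%N.
have {}Llim : forall U, open U -> L `<=` U -> exists N, forall j, (N <= j)%N -> U (p j).
  apply: Llim => j _.
    by have [_ _ + _] := lev j; exact: minimal_closed.
  have [_ _ mLj _] := lev j; have [_ Lpj _ HB] := step j.
  have [_ _ + _] := lev j.+1 => mLj1.
  by have [] := HB _ mLj Lpj (minimal_neq0 mLj1).
have [||N WN] := Llim (~` closure W).
- by apply/closed_openC/closed_closure.
- by move=> x Lx clx; exact: WL clx Lx.
have VN j : (N <= j)%N -> ~ V (p j).
  by move=> /WN nW Vpj; apply: nW; apply: subset_closure; exact: VW.
have yVD : nbhs y (V `&` D N).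
  have [oD Dy _ _] := lev N.
  by apply: filterI; exact: open_nbhs_nbhs.
have [i [mSi [mSN [y' [Siy' [Vy' Dy']]]]]] :
    exists i, minimal_set f (S i) /\ minimal_set (iter (m N) f) (S i `&` D N) /\
      (S i `&` (V `&` D N) !=set0).
  have [_ _ _ mSN] := lev N.
  by have [i [? [? ?]]] := filter_ex (filterI mS (filterI mSN (Sy yVD))); exists i.
(* A single [i] must serve infinitely many levels, so [F] is used at level [N] only. Afterwards [V]
   joins [y] to [y'] off [p j], and the cut at [p j] keeps [y']. *)
have key j : (N <= j)%N -> D j y' /\ minimal_set (iter (m j) f) (S i `&` D j).
  elim: j => [|j IH]; first by rewrite leqn0 => /eqP <-.
  rewrite leq_eqVlt => /orP[/eqP <- //|Nj].
  have [Dj mj] := IH Nj; have [pj Lpj _ HB] := step j.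
  have D1 : D j.+1 y'.
    rewrite DS; split=> //; apply/btwPn; exists V => //; split=> //; exact: VN.
  split=> //; have [||//] := HB _ mj; last by exists y'.
  (* A minimal piece containing its fixed point [p j] reduces to it, which would put [p j = y'] in
     [V]. *)
  move=> Sipj; apply: (VN _ Nj); have : (S i `&` D j) y' by split.
  by rewrite (minimal_fixed hT mj pj Sipj) => <-.
have Slim U : open U -> S i `<=` U -> exists N, forall j, (N <= j)%N -> U (p j).
  move: U; apply: (@tower_limit y D p DS (S i) N) => j Nj.
    by have [_] := key _ Nj; exact: minimal_closed.
  have [Dj mj] := key _ Nj; have [pj Lpj _ HB] := step j.
  have [D1 _] := key _ (leqW Nj).
  have [||//] := HB _ mj; last by exists y'.
  move=> Sipj; apply: (VN _ Nj); have : (S i `&` D j) y' by split.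
  by rewrite (minimal_fixed hT mj pj Sipj) => <-.
have clus B x : closed B ->
    (forall U, open U -> B `<=` U -> exists N, forall j, (N <= j)%N -> U (p j)) ->
    cluster (p @ \oo) x -> B x.
  move=> cB Blim px; apply: contrapT => Bx.
  have oB : open (~` B) by exact: closed_openC.
  have [U xU UB] := compact_regular hT cT filterT (open_nbhs_nbhs (conj oB Bx)).
  have [||N' HN'] := Blim (~` closure U).
  - by apply/closed_openC/closed_closure.
  - by move=> z Bz clz; exact: UB clz Bz.
  have [|z [nUz Uz]] := px (~` closure U) U _ xU; last first.
    by apply: nUz; exact: subset_closure.
  by exists N' => // j /= Nj; exact: HN'.
(* A cluster point of [p] lies in both [L] and [S i], which are then equal; but [y'] is in [S i] and
   not in [L]. *)
have [x [_ px]] := cT (fmap_proper_filter p _) (filterT : (p @ \oo) setT).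
have LSi : L = S i.
  apply: (minimal_meet mL mSi); exists x; split.
    exact: clus (minimal_closed mL) Llim px.
  exact: clus (minimal_closed mSi) Slim px.
apply: (WL y'); first by apply: subset_closure; exact: VW.
by rewrite LSi.
Qed.

End limits_of_minimal_sets.

Lemma lower_limit_minimal (I : Type) (F : set_system I) {FU : UltraFilter F}
    f (S : I -> set T) : continuous f -> monotone_map f ->
  F [set i | minimal_set f (S i)] -> minimal_set f (lower_limit F S).
Proof.
move=> cf mf mS.
have iK : closed_invariant f (lower_limit F S).
  split; [|exact: lower_limit_closed|].
    have [|x [_ Lx]] := lower_limit_hit (S := S) cT closedT; last by exists x.
    by apply: filterS mS => i mSi; rewrite /= setIT; exact: minimal_neq0 mSi.
  have SS : F [set i | f @` (S i) `<=` S i].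
    by apply: filterS mS => i mSi; rewrite /= (minimal_image hT cT cf mSi).
  exact: lower_limit_invariant cf SS.
have [L mL LK] := minimal_exists cT iK.
suff -> : lower_limit F S = L by [].
apply/seteqP; split=> // y Ky; apply: contrapT => Ly.
exact: (lower_limit_not_outside cf mf mS mL LK Ky Ly).
Qed.

End dendrite_dynamics.

(** * Convergence in the Hausdorff metric *)

(** Compactness of [K] makes all its points uniformly close to [F]-many [M]. Conversely, if [F]-many
    [M] met the closed set [far], [lower_limit_hit] would give a point of [K] far from [K]. *)
Lemma hyperspace_ultra_cvg (R : realType) (X : metricType R)
    (cX : compact [set: X]) (F : set_system (hyperspace cX))
    (K : hyperspace cX) : UltraFilter F ->
  lower_limit F (@hyperspace_set R X cX) = K -> F --> K.
Proof.
move=> FU FK N /nbhs_ballP[e /= e0 KN].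
have e20 : 0 < e / 2 by rewrite divr_gt0.
have e40 : 0 < e / 4 by rewrite divr_gt0.
have KM : F [set M : hyperspace cX |
    (K : set X) `<=` (fun x => set_dist x M <= e / 2)].
  have cK : compact (K : set X).
    by apply: closed_compactT => //; exact: hyperspace_closed.
  move/compact_near_coveringP : cK.
  move=> /(_ _ F (fun (M : hyperspace cX) x => set_dist x M <= e / 2)).
  apply=> x; rewrite -FK => /(_ (ball x (e / 4)))Fx.
  exists (ball x (e / 4),
    [set M : hyperspace cX | (M : set X) `&` ball x (e / 4) !=set0]).
    by split; [|apply: Fx]; exact: nbhsx_ballx.
  move=> [x' M] /= [+ [z [Mz]]]; rewrite !ballEmdist /= => xx' xz.
  have := set_dist_le x' Mz; have := metric_triangle x' x z.
  rewrite (metric_sym x' x); lra.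
pose far : set X := [set y | forall z, (K : set X) z -> e / 2 <= mdist y z].
have cfar : closed far.
  move=> y cly z Kz; rewrite leNgt; apply/negP => yz.
  have [|w [fw]] := cly (ball y (e / 2 - mdist y z)).
    by apply: nbhsx_ballx; rewrite subr_gt0.
  rewrite ballEmdist /= => yw; have := fw _ Kz.
  have := metric_triangle w y z; rewrite (metric_sym w y); lra.
have MK : F [set M : hyperspace cX | ~ ((M : set X) `&` far !=set0)].
  have [FM|//] := in_ultra_setVsetC
    [set M : hyperspace cX | (M : set X) `&` far !=set0] FU.
  have [y [fy]] := lower_limit_hit cX cfar FM; rewrite FK => Ky.
  by have := fy _ Ky; rewrite mdistxx leNgt e20.
apply: filterS (filterI KM MK) => M [/= {}KM {}MK]; apply: KN.
rewrite ballEmdist /=.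
have : hausdorff_dist K M <= e / 2.
  rewrite /hausdorff_dist ge_max; apply/andP; split; apply: ge_sup.
  - exact/image_nonempty/hyperspace_neq0.
  - by move=> _ [x Kx <-]; exact: KM.
  - exact/image_nonempty/hyperspace_neq0.
  - move=> _ [y My <-].
    have [z Kz yz] : exists2 z, (K : set X) z & mdist y z < e / 2.
      apply: contrapT => H; apply: MK; exists y; split=> // z Kz.
      by rewrite leNgt; apply/negP => yz; apply: H; exists z.
    exact: le_trans (set_dist_le _ Kz) (ltW yz).
have -> : mdist K M = hausdorff_dist K M by [].
lra.
Qed.

Theorem theorem4p5 (R : realType) (X : metricType R) (hX : dendrite X)
    (f : X -> X) (cf : continuous f) (mf : monotone_map f) :
  compact [set M : hyperspace (dendrite_compact hX) | minimal_set f M].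
Proof.
have [cX connX lcX ncX] := hX.
have htX : hausdorff_space X := metric_hausdorff (T := X).
rewrite compact_ultra => F FU FM.
pose S := @hyperspace_set R X (dendrite_compact hX).
(* The ultrafilter converges to its lower limit, an element of the hyperspace because minimal sets
   are closed and nonempty. *)
have mK : minimal_set f (lower_limit F S).
  apply: (lower_limit_minimal htX cX lcX connX _ _ cf mf FM).
    exact: btw_acc.
  exact: btw_near.
have K0 := minimal_neq0 mK; have cK := minimal_closed mK.
exists (Hyperspace (dendrite_compact hX) K0 cK); split=> //.
exact: hyperspace_ultra_cvg.
Qed.
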